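(* Consider the networked closed-loop system described in the context, with matrices $A,B_1,B_2,C_2,D_2,K$, network delays $\eta_k\in[0,\eta_M]$, and sampling instants generated by the event-trigger $$s_{k+1}=\min\{s\ge s_k+h\mid (y(s)-y(s_k))^T\Omega(y(s)-y(s_k))\ge\varepsilon\, y^T(s)\Omega y(s)\}.$$ For given $\gamma>0$, $h>0$, $\eta_M\ge0$, $\varepsilon\ge0$, $\delta>0$ let there exist real $n\times n$ matrices $P>0$, $S_0\ge0$, $S_1\ge0$, $R_0\ge0$, $R_1\ge0$, $G_1$, $G_0$ and a real $l\times l$ matrix $\Omega\ge0$ such that $$\Psi\le0,\quad \Phi\le0,\quad \begin{bmatrix} R_0 & G_0 \\ G_0^T & R_0 \end{bmatrix}\ge0,\quad \begin{bmatrix} R_1 & G_1 \\ G_1^T & R_1 \end{bmatrix}\ge0,$$ where, with $\tau_M=h+\eta_M$ and $H=\eta_M^2R_0+h^2R_1$, $\Psi=\{\Psi_{ij}\}_{i,j=1}^{7}$ (block sizes $n,n,n,n,n_w,n_v,n$) and $\Phi=\{\Phi_{ij}\}_{i,j=1}^{8}$ (block sizes $n,n,n,n,l,n_w,n_v,n$) are the symmetric block matrices whose upper-triangular blocks are $$\Psi_{11}=\Phi_{11}=A^TP+PA+2\delta P+S_0-e^{-2\delta\eta_M}R_0,$$ $$\Psi_{12}=e^{-2\delta\eta_M}R_0,\qquad \Psi_{14}=PB_2KC_2,$$ $$\Psi_{15}=\Phi_{16}=PB_1,\qquad \Psi_{16}=\Phi_{17}=PB_2KD_2,\qquad \Psi_{17}=\Phi_{18}=A^TH,$$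 $$\Psi_{22}=\Phi_{22}=e^{-2\delta\eta_M}(S_1-S_0-R_0)-e^{-2\delta\tau_M}R_1,$$ $$\Psi_{23}=e^{-2\delta\tau_M}G_1,\qquad \Psi_{24}=e^{-2\delta\tau_M}(R_1-G_1),$$ $$\Psi_{33}=\Phi_{33}=-e^{-2\delta\tau_M}(R_1+S_1),\qquad \Psi_{34}=e^{-2\delta\tau_M}(R_1-G_1^T),$$ $$\Psi_{44}=e^{-2\delta\tau_M}(G_1+G_1^T-2R_1),\qquad \Psi_{47}=\Phi_{48}=(B_2KC_2)^TH,$$ $$\Psi_{55}=\Phi_{66}=-\gamma^2I,\qquad \Psi_{57}=\Phi_{68}=B_1^TH,\qquad \Psi_{77}=\Phi_{88}=-H,$$ $$\Psi_{66}=-\gamma^2I,\qquad \Psi_{67}=\Phi_{78}=(B_2KD_2)^TH,$$ $$\Phi_{12}=e^{-2\delta\eta_M}G_0,\qquad \Phi_{14}=PB_2KC_2+e^{-2\delta\eta_M}(R_0-G_0),$$ $$\Phi_{23}=e^{-2\delta\tau_M}R_1,\qquad \Phi_{24}=e^{-2\delta\eta_M}(R_0-G_0^T),\qquad \Phi_{15}=PB_2K,$$ $$\Phi_{44}=e^{-2\delta\eta_M}(G_0+G_0^T-2R_0)+\varepsilon C_2^T\Omega C_2,\qquad \Phi_{47}=\varepsilon C_2^T\Omega D_2,$$ $$\Phi_{55}=-\Omega,\qquad \Phi_{58}=(B_2K)^TH,\qquad \Phi_{77}=\varepsilon D_2^T\Omega D_2-\gamma^2I,$$ all other upper-triangular blocks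 being zero. Then the closed-loop system under this event-trigger is Input-to-State Stable with respect to $\bar w(t)=\operatorname{col}\{w(t),v(t-\tau(t))\}$.
   Context: For symmetric matrices, $M>0$, $M\ge0$, $M\le0$ mean positive definite, positive semidefinite, negative semidefinite; matrices written $P>0$, $S_i\ge0$, $R_i\ge0$, $\Omega\ge0$ are symmetric. $\operatorname{col}\{\cdot\}$ denotes the stacked column vector. System. The plant is $$\dot x(t)=Ax(t)+B_1w(t)+B_2u(t),\quad y(t)=C_2x(t)+D_2v(t),$$ with state $x\in\mathbb{R}^n$, input $u\in\mathbb{R}^m$, measurement $y\in\mathbb{R}^l$, disturbances $w\in\mathbb{R}^{n_w}$, $v\in\mathbb{R}^{n_v}$; all matrices are real constant matrices of compatible sizes, and $K\in\mathbb{R}^{m\times l}$ is a given gain. The sampling instants form an infinite sequence $0=s_0<s_1<\dots$, $\lim_{k\to\infty}s_k=\infty$. The measurement $y(s_k)$ is subject to a delay $\eta_k$ with $0\le\eta_k\le\eta_M$; the updating times $t_k=s_k+\eta_k$ satisfy $t_k\le t_{k+1}$ for all $k\ge0$. The control is $u(t)=Ky(s_k)$ for $t\in[t_k,t_{k+1})$, so that on $[t_k,t_{k+1})$ the closed-loop system is $$\dot x(t)=Ax(t)+B_1w(t)+B_2K[C_2x(t_k-\eta_k)+D_2v(t_k-\eta_k)].$$ Before the first update, $u(t)=0$ for $t\in[0,t_0)$. Function $\tau(t)$. For $t\in[t_k,\min\{t_k+h,t_{k+1}\})$ put $\tau(t)=t-s_k$. For $t\in[\min\{t_k+h,t_{k+1}\},t_{k+1})$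 put $\tau(t)=\bar\eta(t)$, where $$\bar\eta(t)=\frac{t_{k+1}-t}{t_{k+1}-t_k-h}\,\eta_k+\frac{t-t_k-h}{t_{k+1}-t_k-h}\,\eta_{k+1}.$$ For $t\in[0,t_0)$ the term $v(t-\tau(t))$ is taken to be $0$. With $e(t)=y(s_k)-y(t-\bar\eta(t))$ on $[\min\{t_k+h,t_{k+1}\},t_{k+1})$, the closed-loop system is identical to the switched system $$\dot x(t)=Ax(t)+B_1w(t)+\chi(t)B_2K[C_2x(t-\tau(t))+D_2v(t-\tau(t))]+(1-\chi(t))B_2K[C_2x(t-\bar\eta(t))+D_2v(t-\bar\eta(t))+e(t)],$$ where $\chi(t)=1$ on $[t_k,\min\{t_k+h,t_{k+1}\})$ and $\chi(t)=0$ on $[\min\{t_k+h,t_{k+1}\},t_{k+1})$. Input-to-State Stability with respect to $\bar w$ means: there exist a class $\mathcal{KL}$ function $\beta$ and a class $\mathcal{K}$ function $\rho$ such that for every initial state $x(0)$ and all disturbances with bounded $\bar w$, the solution satisfies $|x(t)|\le\beta(|x(0)|,t)+\rho\bigl(\sup_{0\le s\le t}|\bar w(s)|\bigr)$ for all $t\ge0$. *)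

(* Defs.v *)
From HB Require Import structures.
From mathcomp Require Import all_boot all_order all_algebra.
From mathcomp Require Import all_classical all_reals all_analysis.

Set Implicit Arguments.
Unset Strict Implicit.
Unset Printing Implicit Defensive.

Import Order.TTheory GRing.Theory Num.Theory.
Import numFieldNormedType.Exports.

Local Open Scope classical_set_scope.
Local Open Scope ring_scope.

Section Matrices.
Context {R : realType}.

(* The library norm on matrices is the max norm, hence a separate definition. *)
Definition enorm (p : nat) (z : 'cV[R]_p) : R :=
  Num.sqrt (\sum_(i < p) z i 0 ^+ 2).

Definition qform (p : nat) (M : 'M[R]_p) (z : 'cV[R]_p) : R :=
  (z^T *m M *m z) 0 0.

Definition posdef (p : nat) (M : 'M[R]_p) : Prop :=
  M^T = M /\ forall z : 'cV[R]_p, z != 0 -> 0 < qform M z.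

Definition possemidef (p : nat) (M : 'M[R]_p) : Prop :=
  M^T = M /\ forall z : 'cV[R]_p, 0 <= qform M z.

Definition negsemidef (p : nat) (M : 'M[R]_p) : Prop :=
  M^T = M /\ forall z : 'cV[R]_p, qform M z <= 0.

(* Nesting sblock gives a symmetric block matrix from its upper-triangular
   blocks: the first row of blocks, then what is left below and to the right. *)
Definition sblock (p q : nat) (M11 : 'M[R]_p) (M12 : 'M[R]_(p, q))
    (M22 : 'M[R]_q) : 'M[R]_(p + q) :=
  block_mx M11 M12 M12^T M22.

End Matrices.

Section LinearMatrixInequalities.
Context {R : realType} {n m l nw nv : nat}.
Variables (A : 'M[R]_n) (B1 : 'M[R]_(n, nw)) (B2 : 'M[R]_(n, m)).
Variables (C2 : 'M[R]_(l, n)) (D2 : 'M[R]_(l, nv)) (K : 'M[R]_(m, l)).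
Variables (gamma h etaM eps delta : R).
Variables (P S0 S1 R0 R1 G0 G1 : 'M[R]_n) (Omega : 'M[R]_l).

Let tauM : R := h + etaM.
Let H : 'M[R]_n := etaM ^+ 2 *: R0 + h ^+ 2 *: R1.
Let eeta : R := expR (- (2 * delta * etaM)).
Let etau : R := expR (- (2 * delta * tauM)).
Let M11 : 'M[R]_n :=
  A^T *m P + P *m A + (2 * delta) *: P + S0 - eeta *: R0.
Let M22 : 'M[R]_n := eeta *: (S1 - S0 - R0) - etau *: R1.
Let M33 : 'M[R]_n := - (etau *: (R1 + S1)).

Definition Psi : 'M[R]_(n + (n + (n + (n + (nw + (nv + n)))))) :=
  sblock M11
    (row_mx (eeta *: R0) (row_mx 0 (row_mx (P *m B2 *m K *m C2)
      (row_mx (P *m B1) (row_mx (P *m B2 *m K *m D2) (A^T *m H))))))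
 (sblock M22
    (row_mx (etau *: G1) (row_mx (etau *: (R1 - G1))
      (row_mx 0 (row_mx 0 0))))
 (sblock M33
    (row_mx (etau *: (R1 - G1^T)) (row_mx 0 (row_mx 0 0)))
 (sblock (etau *: (G1 + G1^T - 2 *: R1))
    (row_mx 0 (row_mx 0 ((B2 *m K *m C2)^T *m H)))
 (sblock (- (gamma ^+ 2)%:M)
    (row_mx 0 (B1^T *m H))
 (sblock (- (gamma ^+ 2)%:M)
    ((B2 *m K *m D2)^T *m H)
    (- H)))))).

Definition Phi : 'M[R]_(n + (n + (n + (n + (l + (nw + (nv + n))))))) :=
  sblock M11
    (row_mx (eeta *: G0) (row_mx 0
      (row_mx (P *m B2 *m K *m C2 + eeta *: (R0 - G0))
      (row_mx (P *m B2 *m K) (row_mx (P *m B1)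
      (row_mx (P *m B2 *m K *m D2) (A^T *m H)))))))
 (sblock M22
    (row_mx (etau *: R1) (row_mx (eeta *: (R0 - G0^T))
      (row_mx 0 (row_mx 0 (row_mx 0 0)))))
 (sblock M33
    (row_mx 0 (row_mx 0 (row_mx 0 (row_mx 0 0))))
 (sblock (eeta *: (G0 + G0^T - 2 *: R0) + eps *: (C2^T *m Omega *m C2))
    (row_mx 0 (row_mx 0 (row_mx (eps *: (C2^T *m Omega *m D2))
      ((B2 *m K *m C2)^T *m H))))
 (sblock (- Omega)
    (row_mx 0 (row_mx 0 ((B2 *m K)^T *m H)))
 (sblock (- (gamma ^+ 2)%:M)
    (row_mx 0 (B1^T *m H))
 (sblock (eps *: (D2^T *m Omega *m D2) - (gamma ^+ 2)%:M)
    ((B2 *m K *m D2)^T *m H)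
    (- H))))))).

End LinearMatrixInequalities.

Section ClosedLoop.
Context {R : realType} {n m l nw nv : nat}.
Variables (A : 'M[R]_n) (B1 : 'M[R]_(n, nw)) (B2 : 'M[R]_(n, m)).
Variables (C2 : 'M[R]_(l, n)) (D2 : 'M[R]_(l, nv)) (K : 'M[R]_(m, l)).
Variables (h etaM eps : R) (Omega : 'M[R]_l).

(* x' = f on [0, +oo[ in the sense of Caratheodory. *)
Definition caratheodory (x f : R -> 'cV[R]_n) : Prop :=
  forall (t : R) (i : 'I_n), 0 <= t ->
    lebesgue_measure.-integrable `[0, t] (EFin \o (fun r => f r i 0)) /\
    x t i 0 = x 0 i 0 + \int[lebesgue_measure]_(r in `[0, t]) f r i 0.

Definition sampling_instants (s : nat -> R) : Prop :=
  [/\ s 0%N = 0, forall k, s k < s k.+1 & s @ \oo --> +oo].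

Definition network_delays (s eta : nat -> R) : Prop :=
  forall k, 0 <= eta k <= etaM /\ s k + eta k <= s k.+1 + eta k.+1.

Definition event_triggered (y : R -> 'cV[R]_l) (s : nat -> R) : Prop :=
  forall k,
    let E := [set r | s k + h <= r /\
      eps * qform Omega (y r) <= qform Omega (y r - y (s k))] in
    E (s k.+1) /\ lbound E (s k.+1).

Definition sampled_control (y : R -> 'cV[R]_l) (s eta : nat -> R)
    (u : R -> 'cV[R]_m) : Prop :=
  (forall t, 0 <= t < s 0%N + eta 0%N -> u t = 0) /\
  (forall k t, s k + eta k <= t < s k.+1 + eta k.+1 -> u t = K *m y (s k)).

Definition etabar (s eta : nat -> R) (k : nat) (t : R) : R :=
  let tk := s k + eta k in
  let tk1 := s k.+1 + eta k.+1 in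
  (tk1 - t) / (tk1 - tk - h) * eta k
  + (t - tk - h) / (tk1 - tk - h) * eta k.+1.

(* Nothing is required of tau before the first updating time. *)
Definition switched_delay (s eta : nat -> R) (tau : R -> R) : Prop :=
  forall k t,
    let tk := s k + eta k in
    let tk1 := s k.+1 + eta k.+1 in
    (tk <= t < Num.min (tk + h) tk1 -> tau t = t - s k) /\
    (Num.min (tk + h) tk1 <= t < tk1 -> tau t = etabar s eta k t).

Definition delayed_disturbance (w : R -> 'cV[R]_nw) (v : R -> 'cV[R]_nv)
    (s eta : nat -> R) (tau : R -> R) (t : R) : 'cV[R]_(nw + nv) :=
  col_mx (w t) (if t < s 0%N + eta 0%N then 0 else v (t - tau t)).

(* Pairs of a state trajectory and the corresponding signal
   col {w(t), v(t - tau(t))}, over all disturbances and all admissible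
   realizations of the network delays. *)
Definition closed_loop (x : R -> 'cV[R]_n) (wbar : R -> 'cV[R]_(nw + nv)) :
    Prop :=
  exists (w : R -> 'cV[R]_nw) (v : R -> 'cV[R]_nv) (s eta : nat -> R)
    (u : R -> 'cV[R]_m) (tau : R -> R),
    let y := fun t => C2 *m x t + D2 *m v t in
    [/\ sampling_instants s /\ network_delays s eta,
        event_triggered y s,
        sampled_control y s eta u,
        caratheodory x (fun t => A *m x t + B1 *m w t + B2 *m u t) &
        switched_delay s eta tau /\
        forall t, 0 <= t -> wbar t = delayed_disturbance w v s eta tau t].

End ClosedLoop.

Section InputToStateStability.
Context {R : realType}.

Definition class_K (rho : R -> R) : Prop :=
  [/\ {within `[0, +oo[, continuous rho}, rho 0 = 0 &
      forall a b, 0 <= a -> a < b -> rho a < rho b].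

Definition class_KL (beta : R -> R -> R) : Prop :=
  [/\ {within [set p : R * R | 0 <= p.1 /\ 0 <= p.2],
         continuous (fun p : R * R => beta p.1 p.2)},
      forall t, 0 <= t -> class_K (fun r => beta r t),
      forall r a b, 0 <= r -> 0 <= a -> a <= b -> beta r b <= beta r a &
      forall r, 0 <= r -> beta r t @[t --> +oo] --> 0].

Definition input_to_state_stable (n p : nat)
    (sys : (R -> 'cV[R]_n) -> (R -> 'cV[R]_p) -> Prop) : Prop :=
  exists (beta : R -> R -> R) (rho : R -> R),
    [/\ class_KL beta, class_K rho &
      forall x d, sys x d ->
        (exists M, forall t, 0 <= t -> enorm (d t) <= M) ->
        forall t, 0 <= t ->
          enorm (x t) <= beta (enorm (x 0)) t
                         + rho (sup [set enorm (d r) | r in `[0, t]])].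

End InputToStateStability.

(* Main.v *)
Require Import Defs.
From mathcomp Require Import all_boot all_order all_algebra.
From mathcomp Require Import all_classical all_reals all_analysis.
From mathcomp Require Import measurable_realfun ring lra.

(* Let V be the Lyapunov-Krasovskii functional
     x^T P x + int_(t-etaM)^t x^T S0 x + int_(t-etaM-h)^(t-etaM) x^T S1 x
     + etaM int_(-etaM)^0 int_(t+q)^t x'^T R0 x'
     + h int_(-etaM-h)^(-etaM) int_(t+q)^t x'^T R1 x',
   all integrals over r being weighted by exp(2 delta (r - t)) and x being
   extended by x(0) to negative times. Jensen's inequality and the reciprocally
   convex combination lemma bound the derivative of exp(2 delta t) V by
   exp(2 delta t) times a quadratic form that Psi <= 0 controls when the delay
   exceeds etaM, and Phi <= 0 when it does not. Hence V decays up to a multiple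
   of the squared disturbance. Before the first updating time, which is at most
   etaM, the loop is open and Gronwall's inequality suffices.

   The velocity is only measurable and locally bounded, so derivatives are taken
   in the sense of indefinite Lebesgue integrals. *)

Set Implicit Arguments.
Unset Strict Implicit.
Unset Printing Implicit Defensive.

Import Order.TTheory GRing.Theory Num.Theory.
Import numFieldNormedType.Exports.
Local Open Scope classical_set_scope.
Local Open Scope ring_scope.

(** * Indefinite integrals of locally bounded functions *)

Section Primitives.
Context {R : realType}.
Local Notation mu := (@lebesgue_measure R).
Implicit Types (f g F G : R -> R) (a b c x y : R).

(** The factor exp(2 delta t) does more than encode decay: it turns the moving weight exp(2 delta (r
    - t)) into the fixed weight exp(2 delta r). Every integral in the functional is then a
    difference of one fixed primitive at two instants, and its derivative needs only shifts of
    primitives.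

    Only [wbar] is bounded, so [v] may be arbitrary, even unmeasurable, away from the instants t -
    tau(t). The noise that actually drives the loop is v(s_k), which is v(t - tau(t)) at t = t_k;
    this is what bounds the velocity. In the same way, each delayed measurement fed to the matrix
    inequalities has to be taken either at s_k or at t - tau(t).

    The gain acts on the supremum of [wbar] up to the current time, so nothing may be assumed later.
    Each trajectory is therefore studied on a finite horizon and its velocity is cut off outside it,
    while the constants depend on the system data alone.

    Estimates are carried out for squared norms; square roots are taken only at the very end. *)

Definition loc_bounded f : Prop :=
  forall N, exists M, forall x, `|x| <= N -> `|f x| <= M.

(** [f] plays the derivative of [F]. Local boundedness, stronger than local integrability, makes [F]
    locally Lipschitz; the product rule [primitiveM] rests on it. *)
Definition primitive F f : Prop :=
  [/\ measurable_fun [set: R] f, loc_bounded f &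
      forall a b, a <= b -> F b - F a = \int[mu]_(r in `[a, b]) f r].

Lemma loc_boundedP f : loc_bounded f ->
  forall N, exists2 M, 0 <= M & forall x, `|x| <= N -> `|f x| <= M.
Proof.
move=> lf N; have [M fM] := lf N; exists `|M|; first exact: normr_ge0.
by move=> x /fM/le_trans; apply; exact: ler_norm.
Qed.

Lemma loc_boundedD f g : loc_bounded f -> loc_bounded g ->
  loc_bounded (fun x => f x + g x).
Proof.
move=> lf lg N; have [M fM] := lf N; have [M' gM] := lg N.
exists (M + M') => x xN; apply: (le_trans (ler_normD _ _)).
by rewrite lerD ?fM ?gM.
Qed.

Lemma loc_boundedM f g : loc_bounded f -> loc_bounded g ->
  loc_bounded (fun x => f x * g x).
Proof.
move=> lf lg N; have [M fM] := lf N; have [M' gM] := lg N.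
by exists (M * M') => x xN; rewrite normrM ler_pM ?fM ?gM.
Qed.

Lemma continuous_loc_bounded f : continuous f -> loc_bounded f.
Proof.
move=> cf N.
have /compact_bounded[M [_ Mb]] : compact (f @` `[- N, N]).
  apply: continuous_compact; last exact: segment_compact.
  exact: continuous_subspaceT.
exists (M + 1) => x xN; apply: Mb; first by rewrite ltrDl.
by exists x => //=; rewrite in_itv/= -ler_norml.
Qed.

Lemma loc_integrable f a b : measurable_fun [set: R] f -> loc_bounded f ->
  mu.-integrable `[a, b] (EFin \o f).
Proof.
move=> mf lf; apply: measurable_bounded_integrable => //=.
- rewrite lebesgue_measure_itv/=; case: ifPn => // _.
  by rewrite -EFinB ltry.
- exact: measurable_funTS.
- have [M fM] := lf (`|a| + `|b|).
  exists M; split; first exact: num_real.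
  move=> M' MM' x /=; rewrite in_itv/= => /andP[ax xb].
  apply: le_trans (ltW MM'); apply: fM.
  rewrite ler_norml; apply/andP; split.
    by have := ler_norm (- a); have := normr_ge0 b; rewrite normrN; lra.
  by have := ler_norm b; have := normr_ge0 a; lra.
Qed.

Lemma primitive_exists f : measurable_fun [set: R] f -> loc_bounded f ->
  exists F, primitive F f.
Proof.
move=> mf lf.
(* For each [t] at most one of the two intervals has positive length, so this is the signed integral
   from 0 to [t]. *)
exists (fun t => \int[mu]_(r in `[0, t]) f r - \int[mu]_(r in `[t, 0]) f r).
have oc a b : a <= b ->
    \int[mu]_(r in `]a, b]) f r = \int[mu]_(r in `[a, b]) f r.
  move=> ab; rewrite Rintegral_itv_obnd_cbnd//.
  apply: integrableS (loc_integrable a b mf lf) => //.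
  exact: subset_itv_oc_cc.
have cut a c b : a <= c -> c <= b -> \int[mu]_(r in `[a, b]) f r =
    \int[mu]_(r in `[a, c]) f r + \int[mu]_(r in `[c, b]) f r.
  move=> ac cb; have := @Rintegral_itvB R f (BLeft a) (BRight b) c.
  rewrite !bnd_simp (oc _ _ cb) => <- //; first ring.
  exact: loc_integrable.
have z a : \int[mu]_(r in `[a, a]) f r = 0.
  by rewrite set_itv1 Rintegral_set1.
have z' a b : b < a -> \int[mu]_(r in `[a, b]) f r = 0.
  by move=> ba; rewrite set_itv_ge ?Rintegral_set0// bnd_simp -ltNge.
split=> // a b ab.
have [a0|a0] := leP 0 a.
  have b0 := le_trans a0 ab.
  rewrite (cut 0 a b)//.
  have -> : \int[mu]_(r in `[b, 0]) f r = 0.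
    by move: b0; rewrite le_eqVlt => /predU1P[<-|/z'].
  have -> : \int[mu]_(r in `[a, 0]) f r = 0.
    by move: a0; rewrite le_eqVlt => /predU1P[<-|/z'].
  ring.
have [b0|b0] := leP b 0.
  rewrite (z' 0 a)// (cut a b 0)//.
  have -> : \int[mu]_(r in `[0, b]) f r = 0.
    by move: b0; rewrite le_eqVlt => /predU1P[->|/z'].
  ring.
rewrite (z' 0 a)// (z' b 0)// (cut a 0 b) ?(ltW a0) ?(ltW b0)//; ring.
Qed.

Lemma primitive_cst c : primitive (fun=> c) (fun=> 0).
Proof.
split; first exact: measurable_cst.
  by move=> N; exists 0 => x _; rewrite normr0.
by move=> a b ab; rewrite Rintegral_cst// mul0r subrr.
Qed.

Lemma primitive_id : primitive id (fun=> 1).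
Proof.
split; first exact: measurable_cst.
  by move=> N; exists 1 => x _; rewrite normr1.
move=> a b ab; rewrite Rintegral_cst// mul1r /= lebesgue_measure_itv/= lte_fin.
by move: ab; rewrite le_eqVlt => /predU1P[->|->//]; rewrite ltxx subrr.
Qed.

Lemma primitiveD F G f g : primitive F f -> primitive G g ->
  primitive (fun x => F x + G x) (fun x => f x + g x).
Proof.
move=> [mf lf If] [mg lg Ig]; split.
- exact: measurable_funD.
- exact: loc_boundedD.
- move=> a b ab; rewrite RintegralD//; try exact: loc_integrable.
  by rewrite -If// -Ig//; ring.
Qed.

Lemma primitiveZ c F f : primitive F f ->
  primitive (fun x => c * F x) (fun x => c * f x).
Proof.
move=> [mf lf If]; split.
- by apply: measurable_funM => //; exact: measurable_cst.
- by apply: loc_boundedM => // N; exists `|c|.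
- move=> a b ab; rewrite RintegralZl//; try exact: loc_integrable.
  by rewrite -If//; ring.
Qed.

Lemma primitiveB F G f g : primitive F f -> primitive G g ->
  primitive (fun x => F x - G x) (fun x => f x - g x).
Proof.
move=> pF /(primitiveZ (-1)) pG; have := primitiveD pF pG.
by under eq_fun do rewrite mulN1r; under [X in primitive _ X]eq_fun do rewrite mulN1r.
Qed.

Lemma primitive_sum (I : Type) (r : seq I) (F f : I -> R -> R) :
  (forall i, primitive (F i) (f i)) ->
  primitive (fun x => \sum_(i <- r) F i x) (fun x => \sum_(i <- r) f i x).
Proof.
move=> pF; elim: r => [|i r IH].
  under eq_fun do rewrite big_nil; under [X in primitive _ X]eq_fun do rewrite big_nil.
  exact: primitive_cst.
under eq_fun do rewrite big_cons; under [X in primitive _ X]eq_fun do rewrite big_cons.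
exact: primitiveD.
Qed.

(** Endpoints are null sets, so the integrands are compared only inside. This matters where a
    velocity is unconstrained at an end, as at time 0 for a trajectory that is constant before 0. *)
Lemma primitive_le F G f g a b : primitive F f -> primitive G g -> a <= b ->
  (forall x, a < x < b -> f x <= g x) -> F b - F a <= G b - G a.
Proof.
move=> [mf lf If] [mg lg Ig] ab fg; rewrite If// Ig//.
have oo f0 : measurable_fun [set: R] f0 -> loc_bounded f0 ->
    \int[mu]_(r in `]a, b[) f0 r = \int[mu]_(r in `[a, b]) f0 r /\
    mu.-integrable `]a, b[ (EFin \o f0).
  move=> m0 l0; have i0 := loc_integrable a b m0 l0; split; last first.
    by apply: integrableS i0 => //; exact: subset_itv_oo_cc.
  rewrite -Rintegral_itv_obnd_cbnd; last first.
    by apply: integrableS i0 => //; exact: subset_itv_oc_cc.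
  rewrite -Rintegral_itv_bndo_bndc//.
  by apply: integrableS i0 => //; exact: subset_itv_oo_cc.
have [<- if'] := oo f mf lf; have [<- ig'] := oo g mg lg.
apply: le_Rintegral => //= x; rewrite in_itv/=; exact: fg.
Qed.

Lemma primitive_bound F f M a b : primitive F f -> a <= b ->
  (forall x, a < x < b -> `|f x| <= M) -> `|F b - F a| <= M * (b - a).
Proof.
move=> pF ab fM; have pM c := primitiveZ c primitive_id.
have lo : - M * b - (- M * a) <= F b - F a.
  apply: (primitive_le (pM (- M)) pF ab) => x /fM.
  by rewrite mulr1 ler_norml => /andP[].
have hi : F b - F a <= M * b - M * a.
  apply: (primitive_le pF (pM M) ab) => x /fM.
  by rewrite mulr1 ler_norml => /andP[].
by rewrite ler_norml; apply/andP; split; lra.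
Qed.

Lemma is_derive_approx F x l :
  (forall e, 0 < e -> exists2 d, 0 < d &
     forall y, `|y - x| < d -> `|F y - F x - l * (y - x)| <= e * `|y - x|) ->
  is_derive x 1 F l.
Proof.
move=> H.
have cv : (fun k : R => k^-1 *: (F (k *: (1 : R) + x) - F x)) @ 0^' --> l.
  apply/cvgrPdist_le => e e0; have [d d0 Hd] := H e e0.
  near=> k.
  have k0 : k != 0 by near: k; exact: nbhs_dnbhs_neq.
  have kd : `|k| < d.
    near: k; apply: dnbhs0_lt; exact: d0.
  have := Hd (k + x); rewrite addrK => /(_ kd).
  rewrite /GRing.scale/= mulr1 distrC => Hk.
  rewrite -(ler_pM2r (_ : 0 < `|k|)) ?normr_gt0// -normrM.
  apply: le_trans Hk; rewrite le_eqVlt; apply/orP; left; apply/eqP; congr `|_|.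
  by rewrite mulrBl mulrAC mulVf// mul1r.
split.
  by apply/cvg_ex; exists l.
by apply/cvg_lim.
Unshelve. all: by end_near. Qed.

(** Increments of quadratic order force a zero derivative at every point. This yields the product
    rule without almost-everywhere differentiability. *)
Lemma quadratic_increment_cst F :
  (forall N, exists C, forall a b, a <= b -> `|a| <= N -> `|b| <= N ->
     `|F b - F a| <= C * (b - a) ^+ 2) ->
  forall x y, F x = F y.
Proof.
move=> H x y; apply: is_derive_0_is_cst => {y}z.
apply: is_derive_approx => e e0.
have [C HC] := H (`|z| + 1).
have HC' a b : `|a| <= `|z| + 1 -> `|b| <= `|z| + 1 ->
    `|F b - F a| <= C * `|b - a| ^+ 2.
  move=> aN bN; rewrite real_normK ?num_real//.
  have [ab|/ltW ba] := leP a b; first exact: HC.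
  by rewrite distrC -sqrrN opprB; exact: HC.
(* The 1 keeps [y] in the ball where [C] is valid; the quotient makes [C] times the distance at most
   [e]. *)
exists (Num.min 1 (e / (`|C| + 1))).
  by rewrite lt_min ltr01/= divr_gt0// ltr_pwDr.
move=> y; rewrite lt_min => /andP[y1 y2]; rewrite mul0r subr0.
apply: (le_trans (HC' z y _ _)).
- by rewrite lerDl.
- by rewrite -(subrK z y) addrC (le_trans (ler_normD _ _))// lerD2l ltW.
rewrite expr2 mulrA ler_wpM2r//.
move: y2; rewrite ltr_pdivlMr; last by rewrite ltr_pwDr.
move=> /ltW; apply: le_trans; rewrite mulrC ler_wpM2l//.
by rewrite (le_trans (ler_norm _))// lerDl.
Qed.

Lemma primitive_continuous F f : primitive F f -> continuous F.
Proof.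
move=> pF x; apply/cvgrPdist_le => e e0.
have [_ lf _] := pF; have [M M0 fM] := loc_boundedP lf (`|x| + 1).
have HM a b : `|a| <= `|x| + 1 -> `|b| <= `|x| + 1 ->
    `|F b - F a| <= M * `|b - a|.
  wlog ab : a b / a <= b.
    move=> W aN bN; have [ab|/ltW ba] := leP a b; first exact: W.
    by rewrite distrC [X in _ * X]distrC; exact: W.
  move=> aN bN; rewrite [`|b - a|]ger0_norm ?subr_ge0//.
  apply: (primitive_bound pF ab) => z /andP[az zb]; apply: fM.
  move: aN bN; rewrite !ler_norml => /andP[? ?] /andP[? ?].
  by apply/andP; split; lra.
near=> y.
have y1 : `|y - x| < Num.min 1 (e / (M + 1)).
  near: y; rewrite near_simpl; apply: (@cvgr_distC_lt _ R) => //.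
  by rewrite lt_min ltr01/= divr_gt0// ltr_wpDl.
move: y1; rewrite lt_min => /andP[y1 y2].
rewrite distrC (le_trans (HM _ _ _ _)) ?lerDl//.
  by rewrite -(subrK x y) addrC (le_trans (ler_normD _ _))// lerD2l ltW.
move: y2; rewrite ltr_pdivlMr ?ltr_wpDl// => /ltW; apply: le_trans.
by rewrite mulrC ler_wpM2l// lerDl.
Unshelve. all: by end_near. Qed.

(** Let [I] be a primitive of the candidate derivative. Since F b G b - F a G a = G a (F b - F a) +
    F b (G b - G a), the increment of F G - I over [[a, b]] is minus the integral of f (G - G a) - g
    (F b - F). Both factors in parentheses are of order b - a, so the increment is quadratic and F G
    - I is constant. *)
Lemma primitiveM F G f g : primitive F f -> primitive G g ->
  primitive (fun x => F x * G x) (fun x => f x * G x + F x * g x).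
Proof.
move=> pF pG; have [mf lf If] := pF; have [mg lg Ig] := pG.
have cF := primitive_continuous pF; have cG := primitive_continuous pG.
have mF : measurable_fun [set: R] F by exact: continuous_measurable_fun.
have mG : measurable_fun [set: R] G by exact: continuous_measurable_fun.
have lF := continuous_loc_bounded cF; have lG := continuous_loc_bounded cG.
have mk : measurable_fun [set: R] (fun x => f x * G x + F x * g x).
  by apply: measurable_funD; exact: measurable_funM.
have lk : loc_bounded (fun x => f x * G x + F x * g x).
  by apply: loc_boundedD; exact: loc_boundedM.
have [I pI] := primitive_exists mk lk; have [_ _ II] := pI.
split=> // a b ab; rewrite -II//.
suff /(_ a b) : forall x y, F x * G x - I x = F y * G y - I y by lra.
apply: quadratic_increment_cst => N.
have [Mf Mf0 fM] := loc_boundedP lf N; have [Mg Mg0 gM] := loc_boundedP lg N.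
exists (Mf * Mg + Mg * Mf) => {ab} {}a {}b ab aN bN.
have itvN z : a <= z <= b -> `|z| <= N.
  move: aN bN; rewrite !ler_norml => /andP[? ?] /andP[? ?] /andP[? ?].
  by apply/andP; split; lra.
have incr H h M p q : primitive H h -> (forall x, `|x| <= N -> `|h x| <= M) ->
    0 <= M -> a <= p -> p <= q -> q <= b -> `|H q - H p| <= M * (b - a).
  move=> pH hM M0 ap pq qb; apply: le_trans (_ : M * (q - p) <= _).
    apply: (primitive_bound pH pq) => z /andP[pz zq]; apply: hM; apply: itvN.
    by apply/andP; split; lra.
  by rewrite ler_wpM2l//; lra.
have pK : primitive (fun x => I x - (G a * F x + F b * G x))
   (fun x => f x * G x + F x * g x - (G a * f x + F b * g x)).
  apply: primitiveB => //; apply: primitiveD; exact: primitiveZ.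
have -> : F b * G b - I b - (F a * G a - I a) =
  - ((I b - (G a * F b + F b * G b)) - (I a - (G a * F a + F b * G a))) by ring.
rewrite normrN expr2 mulrA; apply: (primitive_bound pK ab) => x /andP[/ltW ax /ltW xb].
have xN : `|x| <= N by apply: itvN; rewrite ax xb.
have -> : f x * G x + F x * g x - (G a * f x + F b * g x) =
  f x * (G x - G a) - g x * (F b - F x) by ring.
apply: (le_trans (ler_normB _ _)); rewrite !normrM mulrDl -!mulrA lerD//.
  by rewrite ler_pM// ?fM// (incr _ _ _ _ _ pG).
by rewrite ler_pM// ?gM// (incr _ _ _ _ _ pF).
Qed.

(** After subtracting the linear function of slope [f x], the remainder is a primitive of a function
    that continuity makes small near [x]. *)
Lemma continuous_primitive_derive F f : primitive F f -> continuous f ->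
  forall x, is_derive x 1 F (f x).
Proof.
move=> pF cf x; apply: is_derive_approx => e e0.
have /cvgrPdist_le/(_ e e0) := cf x; move=> /nbhs_ballP[d /= d0 Hd].
exists d => // y yd.
have pK : primitive (fun y => F y - f x * y) (fun y => f y - f x * 1).
  by apply: primitiveB => //; apply: primitiveZ; exact: primitive_id.
have -> : F y - F x - f x * (y - x) = (F y - f x * y) - (F x - f x * x) by ring.
have bd z : `|z - x| < d -> `|f z - f x * 1| <= e.
  by move=> zd; rewrite mulr1 distrC; apply: Hd; rewrite /ball/= distrC.
have [xy|/ltW yx] := leP x y.
  rewrite [`|y - x|]ger0_norm ?subr_ge0//.
  apply: (primitive_bound pK xy) => z /andP[? ?]; apply: bd.
  by move: yd; rewrite !ltr_norml => /andP[? ?]; apply/andP; split; lra.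
rewrite [`|y - x|]distrC [`|x - y|]ger0_norm ?subr_ge0// distrC.
apply: (primitive_bound pK yx) => z /andP[? ?]; apply: bd.
by move: yd; rewrite distrC !ltr_norml => /andP[? ?]; apply/andP; split; lra.
Qed.

Lemma primitive_of_derive F f : continuous f ->
  (forall x, is_derive x 1 F (f x)) -> primitive F f.
Proof.
move=> cf dF; have mf : measurable_fun [set: R] f by exact: continuous_measurable_fun.
have lf := continuous_loc_bounded cf.
have [G pG] := primitive_exists mf lf; have [_ _ IG] := pG.
split=> // a b ab; rewrite -IG//.
have dG := continuous_primitive_derive pG cf.
suff : (F - G) a = (F - G) b by rewrite !fctE; lra.
apply: is_derive_0_is_cst => x; have := is_deriveB (dF x) (dG x).
by rewrite subrr.
Qed.

(** The chain rule for ordinary derivatives gives this for continuous integrands. That is enough: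
    the functional delays only primitives of continuous functions, the merely measurable velocity
    terms being integrated twice wherever they are delayed. *)
Lemma primitive_shift F f c : primitive F f -> continuous f ->
  primitive (fun x => F (x - c)) (fun x => f (x - c)).
Proof.
move=> pF cf; have dF := continuous_primitive_derive pF cf.
apply: primitive_of_derive.
  move=> x; apply: continuous_comp; last exact: cf.
  by apply: cvgB; [exact: cvg_id|exact: cvg_cst].
move=> x.
have d1 : is_derive x 1 (fun y : R => y - c) 1.
  by rewrite -[X in is_derive _ _ _ X]subr0; apply: is_deriveB.
by have := @is_derive1_comp R F (fun y => y - c) x _ _ (dF (x - c)) d1; rewrite mulr1.
Qed.

Lemma primitive_expR c :
  primitive (fun t => expR (c * t)) (fun t => c * expR (c * t)).
Proof.
have cm : continuous (fun t : R => c * t).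
  by move=> x; apply: cvgM; [exact: cvg_cst|exact: cvg_id].
apply: primitive_of_derive.
  move=> x; apply: cvgM; first exact: cvg_cst.
  by apply: continuous_comp; [exact: cm|exact: continuous_expR].
move=> x.
have d1 : is_derive x 1 (fun t : R => c * t) c.
  have := @is_deriveZ R R R id c x 1 1 (is_derive_id _ _).
  by rewrite /GRing.scale/= mulr1.
have := @is_derive1_comp R expR (fun t => c * t) x _ _ (is_derive_expR (c * x)) d1.
by rewrite mulrC.
Qed.

Lemma primitive_eq F G f g : F =1 G -> f =1 g -> primitive F f -> primitive G g.
Proof. by move=> /funext -> /funext ->. Qed.

End Primitives.

(** * Bilinear forms and the matrix inequalities *)

Section BilinearForms.
Context {R : realType}.

Definition bform (p q : nat) (M : 'M[R]_(p, q)) (a : 'cV[R]_p) (b : 'cV[R]_q) : R :=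
  (a^T *m M *m b) 0 0.

Definition sqnorm (p : nat) (a : 'cV[R]_p) : R := bform 1%:M a a.

Lemma qformE p (M : 'M[R]_p) a : qform M a = bform M a a. Proof. by []. Qed.

Section BformTheory.
Variables (p q : nat).
Implicit Types (M N : 'M[R]_(p, q)) (a : 'cV[R]_p) (b : 'cV[R]_q).

Lemma bformDm M N a b : bform (M + N) a b = bform M a b + bform N a b.
Proof. by rewrite /bform mulmxDr mulmxDl mxE. Qed.

Lemma bformNm M a b : bform (- M) a b = - bform M a b.
Proof. by rewrite /bform mulmxN mulNmx mxE. Qed.

Lemma bformZm c M a b : bform (c *: M) a b = c * bform M a b.
Proof. by rewrite /bform -scalemxAr -scalemxAl mxE. Qed.

Lemma bform0m a b : bform (0 : 'M[R]_(p, q)) a b = 0.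
Proof. by rewrite /bform mulmx0 mul0mx mxE. Qed.

Lemma bformDl M a a' b : bform M (a + a') b = bform M a b + bform M a' b.
Proof. by rewrite /bform linearD/= !mulmxDl mxE. Qed.

Lemma bformDr M a b b' : bform M a (b + b') = bform M a b + bform M a b'.
Proof. by rewrite /bform mulmxDr mxE. Qed.

Lemma bformNl M a b : bform M (- a) b = - bform M a b.
Proof. by rewrite /bform linearN/= !mulNmx mxE. Qed.

Lemma bformNr M a b : bform M a (- b) = - bform M a b.
Proof. by rewrite /bform mulmxN mxE. Qed.

Lemma bformZl c M a b : bform M (c *: a) b = c * bform M a b.
Proof. by rewrite /bform linearZ/= -!scalemxAl mxE. Qed.

Lemma bformZr c M a b : bform M a (c *: b) = c * bform M a b.
Proof. by rewrite /bform -scalemxAr mxE. Qed.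

Lemma bform0l M b : bform M 0 b = 0.
Proof. by rewrite /bform trmx0 !mul0mx mxE. Qed.

Lemma bform0r M a : bform M a 0 = 0.
Proof. by rewrite /bform mulmx0 mxE. Qed.

Lemma bform_tr M a b : bform M^T b a = bform M a b.
Proof.
rewrite /bform -[RHS](mxE trmx_key (fun i j => (a^T *m M *m b) j i)) -/(trmx _).
by rewrite !trmx_mul trmxK mulmxA.
Qed.

Lemma bformE M a b :
  bform M a b = \sum_(i < p) \sum_(j < q) M i j * (a i 0 * b j 0).
Proof.
rewrite /bform mxE exchange_big; apply: eq_bigr => j _.
rewrite mxE mulr_suml; apply: eq_bigr => i _; rewrite mxE; ring.
Qed.

End BformTheory.

Definition bform_lin := (bformDm, bformNm, bformZm, bform0m).

Lemma bform_mulr p q r (M : 'M[R]_(p, q)) (N : 'M[R]_(q, r)) a b :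
  bform (M *m N) a b = bform M a (N *m b).
Proof. by rewrite /bform !mulmxA. Qed.

Lemma bform_trmul p q r (M : 'M[R]_(p, q)) (N : 'M[R]_(p, r)) a b :
  bform (N^T *m M) a b = bform M (N *m a) b.
Proof. by rewrite /bform trmx_mul !mulmxA. Qed.

Lemma bform_row p q r (M : 'M[R]_(p, q)) (N : 'M[R]_(p, r)) a b c :
  bform (row_mx M N) a (col_mx b c) = bform M a b + bform N a c.
Proof. by rewrite /bform mul_mx_row mul_row_col mxE. Qed.

Lemma bform_scalar p c (a : 'cV[R]_p) : bform c%:M a a = c * sqnorm a.
Proof. by rewrite -scalemx1 bformZm. Qed.

Lemma bform_sym p (M : 'M[R]_p) a b : M^T = M -> bform M b a = bform M a b.
Proof. by move=> MT; rewrite -{1}MT bform_tr. Qed.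

Lemma bform_sblock p q (M11 : 'M[R]_p) (M12 : 'M[R]_(p, q)) (M22 : 'M[R]_q) a b :
  bform (sblock M11 M12 M22) (col_mx a b) (col_mx a b) =
  bform M11 a a + 2 * bform M12 a b + bform M22 b b.
Proof.
rewrite /sblock /block_mx {1}/bform tr_col_mx mul_row_col mulmxDl mxE.
rewrite -2!/(bform _ _ _) !bform_row bform_tr; ring.
Qed.

Lemma sqnormE p (a : 'cV[R]_p) : sqnorm a = \sum_(i < p) a i 0 ^+ 2.
Proof.
rewrite /sqnorm /bform mulmx1 mxE; apply: eq_bigr => i _.
by rewrite mxE expr2.
Qed.

Lemma sqnorm_ge0 p (a : 'cV[R]_p) : 0 <= sqnorm a.
Proof. by rewrite sqnormE sumr_ge0// => i _; rewrite sqr_ge0. Qed.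

End BilinearForms.

Section LMIForms.
Context {R : realType} {n m l nw nv : nat}.
Variables (A : 'M[R]_n) (B1 : 'M[R]_(n, nw)) (B2 : 'M[R]_(n, m)).
Variables (C2 : 'M[R]_(l, n)) (D2 : 'M[R]_(l, nv)) (K : 'M[R]_(m, l)).
Variables (gamma h etaM eps delta : R).
Variables (P S0 S1 R0 R1 G0 G1 : 'M[R]_n) (Omega : 'M[R]_l).
Let H := etaM ^+ 2 *: R0 + h ^+ 2 *: R1.
Let eeta : R := expR (- (2 * delta * etaM)).
Let etau : R := expR (- (2 * delta * (h + etaM))).
Hypotheses (PT : P^T = P) (R0T : R0^T = R0) (R1T : R1^T = R1).
Hypothesis OmegaT : Omega^T = Omega.

(* The last block of the test vector is the velocity f itself, so that the
   H-blocks contribute exactly f^T H f and no Schur complement is needed. *)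
Lemma qform_Psi (x0 x1 x2 x3 f : 'cV[R]_n) (om : 'cV[R]_nw) (nu : 'cV[R]_nv) :
  f = A *m x0 + B1 *m om + B2 *m (K *m (C2 *m x3 + D2 *m nu)) ->
  qform (Psi A B1 B2 C2 D2 K gamma h etaM delta P S0 S1 R0 R1 G1)
    (col_mx x0 (col_mx x1 (col_mx x2 (col_mx x3 (col_mx om (col_mx nu f)))))) =
  2 * bform P x0 f + 2 * delta * bform P x0 x0 + bform S0 x0 x0
  + eeta * (bform S1 x1 x1 - bform S0 x1 x1) - etau * bform S1 x2 x2
  - eeta * bform R0 (x0 - x1) (x0 - x1)
  - etau * (bform R1 (x1 - x3) (x1 - x3) + bform R1 (x3 - x2) (x3 - x2)
            + 2 * bform G1 (x1 - x3) (x3 - x2))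
  + bform H f f - gamma ^+ 2 * (sqnorm om + sqnorm nu).
Proof.
move=> fE.
have Pf : bform P x0 f = bform P x0 (A *m x0) + bform P x0 (B1 *m om)
   + bform P x0 (B2 *m (K *m (C2 *m x3))) + bform P x0 (B2 *m (K *m (D2 *m nu))).
  by rewrite fE !mulmxDr !bformDr addrA.
(* Only the left [f] is expanded: the off-diagonal H-blocks pair the summands of [f] with the last
   test block. They add up to twice f^T H f, and the diagonal block [- H] takes one copy away. *)
have Hf : bform H f f = bform H (A *m x0) f + bform H (B1 *m om) f
   + bform H (B2 *m (K *m (C2 *m x3))) f + bform H (B2 *m (K *m (D2 *m nu))) f.
  by rewrite {1}fE !mulmxDr !bformDl addrA.
rewrite qformE /Psi -/H -/eeta -/etau; clearbody H eeta etau.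
rewrite !bform_sblock !bform_row.
rewrite !bform_lin !bform_trmul !(bform_lin, bform_mulr, bform_scalar, bform_tr).
rewrite -?mulmxA Pf Hf.
rewrite !(bformDl, bformDr, bformNl, bformNr).
rewrite (bform_sym x0 (A *m x0) PT).
rewrite (bform_sym x0 x1 R0T) (bform_sym x1 x3 R1T) (bform_sym x3 x2 R1T).
by ring.
Qed.

Lemma qform_Phi (x0 x1 x2 x3 f : 'cV[R]_n) (e : 'cV[R]_l)
    (om : 'cV[R]_nw) (nu : 'cV[R]_nv) :
  f = A *m x0 + B1 *m om + B2 *m (K *m (C2 *m x3 + D2 *m nu + e)) ->
  qform (Phi A B1 B2 C2 D2 K gamma h etaM eps delta P S0 S1 R0 R1 G0 Omega)
    (col_mx x0 (col_mx x1 (col_mx x2 (col_mx x3 (col_mx e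
      (col_mx om (col_mx nu f))))))) =
  2 * bform P x0 f + 2 * delta * bform P x0 x0 + bform S0 x0 x0
  + eeta * (bform S1 x1 x1 - bform S0 x1 x1) - etau * bform S1 x2 x2
  - eeta * (bform R0 (x0 - x3) (x0 - x3) + bform R0 (x3 - x1) (x3 - x1)
            + 2 * bform G0 (x0 - x3) (x3 - x1))
  - etau * bform R1 (x1 - x2) (x1 - x2)
  + eps * qform Omega (C2 *m x3 + D2 *m nu) - qform Omega e
  + bform H f f - gamma ^+ 2 * (sqnorm om + sqnorm nu).
Proof.
move=> fE.
have Pf : bform P x0 f = bform P x0 (A *m x0) + bform P x0 (B1 *m om)
   + bform P x0 (B2 *m (K *m (C2 *m x3))) + bform P x0 (B2 *m (K *m (D2 *m nu)))
   + bform P x0 (B2 *m (K *m e)).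
  by rewrite fE !mulmxDr !bformDr !addrA.
have Hf : bform H f f = bform H (A *m x0) f + bform H (B1 *m om) f
   + bform H (B2 *m (K *m (C2 *m x3))) f + bform H (B2 *m (K *m (D2 *m nu))) f
   + bform H (B2 *m (K *m e)) f.
  by rewrite {1}fE !mulmxDr !bformDl !addrA.
rewrite !qformE /Phi -/H -/eeta -/etau; clearbody H eeta etau.
rewrite !bform_sblock !bform_row.
rewrite -!(mulmxA _ Omega) !bform_lin !bform_trmul.
rewrite !(bform_lin, bform_mulr, bform_scalar, bform_tr).
rewrite -?mulmxA Pf Hf.
rewrite !(bformDl, bformDr, bformNl, bformNr).
rewrite (bform_sym x0 (A *m x0) PT) (bform_sym x0 x3 R0T) (bform_sym x3 x1 R0T).
rewrite (bform_sym x1 x2 R1T) (bform_sym (C2 *m x3) (D2 *m nu) OmegaT).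
by ring.
Qed.

End LMIForms.

(** * Inequalities for semidefinite and definite forms *)

Section Semidefinite.
Context {R : realType}.

Lemma cauchy_schwarz p (M : 'M[R]_p) a b : possemidef M ->
  bform M a b ^+ 2 <= bform M a a * bform M b b.
Proof.
move=> [MT M0].
have H t : 0 <= bform M a a - 2 * t * bform M a b + t ^+ 2 * bform M b b.
  have := M0 (a - t *: b); rewrite qformE.
  rewrite !(bformDl, bformDr, bformNl, bformNr, bformZl, bformZr).
  rewrite (bform_sym a b MT); congr (_ <= _); ring.
have b0 : 0 <= bform M b b by exact: M0.
have a0 : 0 <= bform M a a by exact: M0.
move: b0; rewrite le_eqVlt => /predU1P[bz|b0].
  rewrite -bz mulr0 in H *.
  have [->|n0] := eqVneq (bform M a b) 0; first by rewrite expr0n.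
  (* In a null direction [b] the polynomial in [t] is affine; at this [t] it would equal -1. *)
  have := H ((bform M a a + 1) / (2 * bform M a b)).
  have -> : 2 * ((bform M a a + 1) / (2 * bform M a b)) * bform M a b =
    bform M a a + 1 by field.
  by rewrite ?mulr0; lra.
have := H (bform M a b / bform M b b).
have -> : bform M a a - 2 * (bform M a b / bform M b b) * bform M a b +
  (bform M a b / bform M b b) ^+ 2 * bform M b b =
  (bform M a a * bform M b b - bform M a b ^+ 2) / bform M b b.
  by field; rewrite gt_eqF.
by rewrite pmulr_lge0 ?invr_gt0// subr_ge0.
Qed.

(** The i-th coordinate of [z] is the [M]-product of [z] with M^-1 e_i, so Cauchy-Schwarz bounds its
    square. The constant obtained is the trace of M^-1; no eigenvalues are involved. *)
Lemma posdef_lower_bound p (M : 'M[R]_p) : posdef M ->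
  exists2 c, 0 <= c & forall z, sqnorm z <= c * bform M z z.
Proof.
move=> [MT M0].
have psd : possemidef M.
  split=> // z; have [->|/M0/ltW//] := eqVneq z 0.
  by rewrite qformE bform0l.
have uM : M \in unitmx.
  rewrite -row_free_unit -kermx_eq0; apply/rowV0P => v /sub_kermxP vM.
  apply/eqP; apply: contraT => v0.
  have := M0 v^T; rewrite -(inj_eq trmx_inj) trmxK trmx0 => /(_ v0).
  by rewrite qformE /bform trmxK vM mul0mx mxE ltxx.
exists (\sum_(i < p) bform M (invmx M *m delta_mx i 0) (invmx M *m delta_mx i 0)).
  by rewrite sumr_ge0// => i _; exact: psd.2.
move=> z; rewrite sqnormE mulr_suml; apply: ler_sum => i _.
have -> : z i 0 = bform M (invmx M *m delta_mx i 0) z.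
  rewrite /bform trmx_mul trmx_inv MT -mulmxA mulmxA mulmxKV//.
  by rewrite trmx_delta -rowE mxE.
exact: cauchy_schwarz.
Qed.

Lemma bform_upper_bound p q (M : 'M[R]_(p, q)) :
  exists2 c, 0 <= c & forall a b, `|bform M a b| <= c * (sqnorm a + sqnorm b).
Proof.
exists (\sum_(i < p) \sum_(j < q) `|M i j|).
  by rewrite sumr_ge0// => i _; rewrite sumr_ge0.
move=> a b; rewrite bformE mulr_suml; apply: le_trans (ler_norm_sum _ _ _) _.
apply: ler_sum => i _; rewrite mulr_suml; apply: le_trans (ler_norm_sum _ _ _) _.
apply: ler_sum => j _; rewrite normrM ler_wpM2l//.
have ha : a i 0 ^+ 2 <= sqnorm a.
  by rewrite sqnormE (bigD1 i)//= lerDl sumr_ge0// => k _; rewrite sqr_ge0.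
have hb : b j 0 ^+ 2 <= sqnorm b.
  by rewrite sqnormE (bigD1 j)//= lerDl sumr_ge0// => k _; rewrite sqr_ge0.
apply: le_trans (lerD ha hb); rewrite ler_norml.
have := sqr_ge0 (a i 0 - b j 0); have := sqr_ge0 (a i 0 + b j 0).
have := sqr_ge0 (a i 0); have := sqr_ge0 (b j 0).
by move=> ? ? ? ?; apply/andP; split; nra.
Qed.

Lemma sqnorm_mulmx_bound p q (M : 'M[R]_(p, q)) :
  exists2 c, 0 <= c & forall a, sqnorm (M *m a) <= c * sqnorm a.
Proof.
have [c c0 H] := bform_upper_bound (M^T *m 1%:M *m M).
exists (c + c); first exact: addr_ge0.
move=> a; have := H a a; rewrite bform_mulr bform_trmul => /(le_trans (ler_norm _)).
by rewrite -/(sqnorm _) mulrDl mulrDr.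
Qed.

Lemma sqnormD_le p (a b : 'cV[R]_p) :
  sqnorm (a + b) <= 2 * sqnorm a + 2 * sqnorm b.
Proof.
have := sqnorm_ge0 (a - b).
rewrite /sqnorm !(bformDl, bformDr, bformNl, bformNr); lra.
Qed.

Lemma bform_block_ge0 p (M G : 'M[R]_p) : M^T = M ->
  possemidef (block_mx M G G^T M) ->
  forall a b, 0 <= bform M a a + 2 * bform G a b + bform M b b.
Proof.
move=> MT [_ H] a b; have := H (col_mx a b).
by rewrite qformE (bform_sblock M G M).
Qed.

(** Testing the block matrix on (L2 a, - L1 b) and dividing by L1 L2 gives 2 a^T G b <= (L2 / L1)
    a^T M a + (L1 / L2) b^T M b. The left side is then at most (L1 + L2) (a^T M a / L1 + b^T M b /
    L2). The implications for zero lengths cover a delay at an end of its range, where one cannot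
    divide. *)
Lemma reciprocally_convex p (M G : 'M[R]_p) a b (X Y L1 L2 : R) :
  M^T = M -> possemidef (block_mx M G G^T M) ->
  0 <= L1 -> 0 <= L2 -> 0 <= X -> 0 <= Y ->
  (L1 = 0 -> a = 0) -> (L2 = 0 -> b = 0) ->
  bform M a a <= L1 * X -> bform M b b <= L2 * Y ->
  bform M a a + bform M b b + 2 * bform G a b <= (L1 + L2) * (X + Y).
Proof.
move=> MT MG L10 L20 X0 Y0 az bz aX bY; have pos := bform_block_ge0 MT MG.
move: L10; rewrite le_eqVlt => /predU1P[L1z|L10].
  rewrite (az (esym L1z)) -L1z !bform0l add0r; nra.
move: L20; rewrite le_eqVlt => /predU1P[L2z|L20].
  rewrite (bz (esym L2z)) -L2z !bform0r; nra.
have := pos (L2 *: a) (- L1 *: b).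
rewrite !(bformZl, bformZr) => H.
have L12 : 0 < L1 * L2 by exact: mulr_gt0.
rewrite -(ler_pM2l L12) -subr_ge0.
have hX : 0 <= L2 * (L1 + L2) * (L1 * X - bform M a a).
  by rewrite mulr_ge0 ?subr_ge0// mulr_ge0 ?addr_ge0 ?ltW.
have hY : 0 <= L1 * (L1 + L2) * (L2 * Y - bform M b b).
  by rewrite mulr_ge0 ?subr_ge0// mulr_ge0 ?addr_ge0 ?ltW.
apply: le_trans (addr_ge0 (addr_ge0 hX hY) H) _.
by rewrite le_eqVlt; apply/orP; left; apply/eqP; ring.
Qed.

End Semidefinite.

(** * Vector-valued primitives and Jensen's inequality *)

Section VectorPrimitives.
Context {R : realType} {p : nat}.
Implicit Types (X F : R -> 'cV[R]_p) (M : 'M[R]_p).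

Definition vprimitive X F : Prop :=
  forall i, primitive (fun t => X t i 0) (fun t => F t i 0).

Lemma measurable_bform M F : (forall i, measurable_fun [set: R] (fun t => F t i 0)) ->
  measurable_fun [set: R] (fun t => bform M (F t) (F t)).
Proof.
move=> mF; under eq_fun do rewrite bformE.
apply: measurable_sum => i; apply: measurable_sum => j.
apply: measurable_funM; first exact: measurable_cst.
exact: measurable_funM.
Qed.

Lemma loc_bounded_sum (I : Type) (r : seq I) (f : I -> R -> R) :
  (forall i, loc_bounded (f i)) -> loc_bounded (fun x => \sum_(i <- r) f i x).
Proof.
move=> lf; elim: r => [|i r IH].
  by move=> N; exists 0 => x _; rewrite big_nil normr0.
under eq_fun do rewrite big_cons; exact: loc_boundedD.
Qed.

Lemma loc_bounded_bform M F : (forall i, loc_bounded (fun t => F t i 0)) ->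
  loc_bounded (fun t => bform M (F t) (F t)).
Proof.
move=> lF; under eq_fun do rewrite bformE.
apply: loc_bounded_sum => i; apply: loc_bounded_sum => j.
apply: loc_boundedM; first by move=> N; exists `|M i j|.
exact: loc_boundedM.
Qed.

Lemma primitive_bform M X F : M^T = M -> vprimitive X F ->
  primitive (fun t => bform M (X t) (X t)) (fun t => 2 * bform M (X t) (F t)).
Proof.
move=> MT pX.
have := primitive_sum (index_enum 'I_p) (fun i => primitive_sum (index_enum 'I_p)
  (fun j => primitiveZ (M i j) (primitiveM (pX i) (pX j)))).
apply: primitive_eq => t; first by rewrite bformE.
rewrite mulr_natl mulr2n -{1}(bform_sym _ _ MT) !bformE -big_split/=.
apply: eq_bigr => i _; rewrite -big_split/=; apply: eq_bigr => j _; ring.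
Qed.

Lemma primitive_bform_cst M a X F : vprimitive X F ->
  primitive (fun t => bform M a (X t)) (fun t => bform M a (F t)).
Proof.
move=> pX.
have := primitive_sum (index_enum 'I_p) (fun i => primitive_sum (index_enum 'I_p)
  (fun j => primitiveZ (M i j * a i 0) (pX j))).
apply: primitive_eq => t; rewrite bformE; apply: eq_bigr => i _;
  by apply: eq_bigr => j _; rewrite mulrA.
Qed.

Lemma vprimitive_constant X F a b : vprimitive X F -> a <= b ->
  (forall r, a < r < b -> F r = 0) -> X a = X b.
Proof.
move=> pX ab F0; apply/matrixP => i j; rewrite ord1.
have := primitive_bound (M := 0) (pX i) ab; rewrite mul0r normr_le0 subr_eq0.
by move=> H; apply/esym/eqP/H => r /F0 ->; rewrite mxE normr0.
Qed.

(** Integrate (F - eta)^T M (F - eta) >= 0, where [eta] is the mean velocity on [[a, b]]. The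
    constant [c] is a lower bound for the weight contained in [g]. *)
Lemma jensen M X F G g c a b : possemidef M -> vprimitive X F -> primitive G g ->
  0 < c -> a <= b -> (forall r, a < r < b -> c * bform M (F r) (F r) <= g r) ->
  bform M (X b - X a) (X b - X a) <= (b - a) * ((G b - G a) / c).
Proof.
move=> [MT M0] pX pG c0; rewrite le_eqVlt => /predU1P[<- _|ab Fg].
  by rewrite !subrr bform0l mul0r.
set xi := X b - X a; have ba : 0 < b - a by rewrite subr_gt0.
pose eta := (b - a)^-1 *: xi.
have pK := primitiveZ c (primitiveB (primitiveZ 2 (primitive_bform_cst M eta pX))
  (primitiveZ (bform M eta eta) (primitive_id (R := R)))).
have /= := primitive_le pK pG (ltW ab); rewrite mulr1 => H.
rewrite mulrA ler_pdivlMr// mulrC -ler_pdivrMl//.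
apply: le_trans (H _) => [|r /Fg]; last first.
  apply: le_trans; rewrite ler_pM2l//.
  have := M0 (F r - eta); rewrite qformE.
  rewrite !(bformDl, bformDr, bformNl, bformNr) (bform_sym eta (F r) MT); lra.
rewrite -mulrBr; rewrite le_eqVlt; apply/orP; left; apply/eqP.
have -> : 2 * bform M eta (X b) - bform M eta eta * b -
  (2 * bform M eta (X a) - bform M eta eta * a) =
  2 * bform M eta xi - bform M eta eta * (b - a).
  rewrite /xi bformDr bformNr; ring.
rewrite /eta !(bformZl, bformZr); field; exact: lt0r_neq0.
Qed.

End VectorPrimitives.

(** * The Lyapunov-Krasovskii functional *)

Section Lyapunov.
Context {R : realType} {n m l nw nv : nat}.
Variables (A : 'M[R]_n) (B1 : 'M[R]_(n, nw)) (B2 : 'M[R]_(n, m)).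
Variables (C2 : 'M[R]_(l, n)) (D2 : 'M[R]_(l, nv)) (K : 'M[R]_(m, l)).
Variables (gamma h etaM eps delta : R).
Variables (P S0 S1 R0 R1 G0 G1 : 'M[R]_n) (Omega : 'M[R]_l).
Hypotheses (h0 : 0 < h) (etaM0 : 0 <= etaM) (delta0 : 0 < delta).
Hypothesis P_posdef : posdef P.
Hypotheses (S0_psd : possemidef S0) (S1_psd : possemidef S1).
Hypotheses (R0_psd : possemidef R0) (R1_psd : possemidef R1).
Hypothesis Omega_psd : possemidef Omega.
Hypothesis Psi_nsd :
  negsemidef (Psi A B1 B2 C2 D2 K gamma h etaM delta P S0 S1 R0 R1 G1).
Hypothesis Phi_nsd :
  negsemidef (Phi A B1 B2 C2 D2 K gamma h etaM eps delta P S0 S1 R0 R1 G0 Omega).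
Hypothesis RG0_psd : possemidef (block_mx R0 G0 G0^T R0).
Hypothesis RG1_psd : possemidef (block_mx R1 G1 G1^T R1).

(* The first alternative is the one that Psi handles, the second Phi. *)
Definition admissible_velocity (X F : R -> 'cV[R]_n) (D t : R) : Prop :=
  exists (tau : R) (om : 'cV[R]_nw) (nu : 'cV[R]_nv) (e : 'cV[R]_l),
  [/\ 0 <= tau <= h + etaM,
      F t = A *m X t + B1 *m om + B2 *m (K *m (C2 *m X (t - tau) + D2 *m nu + e)),
      sqnorm om + sqnorm nu <= D &
      (etaM <= tau /\ e = 0) \/
      (tau <= etaM /\
       qform Omega e <= eps * qform Omega (C2 *m X (t - tau) + D2 *m nu))].

Section Trajectory.
Variables (X F : R -> 'cV[R]_n).
Hypothesis XF : vprimitive X F.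

Let q (S : 'M[R]_n) t := expR (2 * delta * t) * bform S (X t) (X t).
Let r (S : 'M[R]_n) t := expR (2 * delta * t) * bform S (F t) (F t).

Variables (Q0 Q1 g0 g1 J0 J1 : R -> R).
Hypotheses (Q0P : primitive Q0 (q S0)) (Q1P : primitive Q1 (q S1)).
Hypotheses (g0P : primitive g0 (r R0)) (g1P : primitive g1 (r R1)).
Hypotheses (J0P : primitive J0 g0) (J1P : primitive J1 g1).

(* exp(2 delta t) V(t) for the Lyapunov-Krasovskii functional V, the double
   integrals being rewritten with iterated primitives. *)
Definition functional (t : R) : R :=
  q P t + (Q0 t - Q0 (t - etaM)) + (Q1 (t - etaM) - Q1 (t - (h + etaM)))
  + etaM * (etaM * g0 t - (J0 t - J0 (t - etaM)))
  + h * (h * g1 t - (J1 (t - etaM) - J1 (t - (h + etaM)))).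

Let dfunctional (t : R) : R :=
  2 * delta * q P t + expR (2 * delta * t) * (2 * bform P (X t) (F t))
  + (q S0 t - q S0 (t - etaM)) + (q S1 (t - etaM) - q S1 (t - (h + etaM)))
  + etaM * (etaM * r R0 t - (g0 t - g0 (t - etaM)))
  + h * (h * r R1 t - (g1 (t - etaM) - g1 (t - (h + etaM)))).

Let psd_sym p (M : 'M[R]_p) : possemidef M -> M^T = M. Proof. by case. Qed.

Let q_continuous S : S^T = S -> continuous (q S).
Proof.
move=> ST; apply: primitive_continuous.
exact: primitiveM (primitive_expR _) (primitive_bform ST XF).
Qed.

Lemma primitive_functional : primitive functional dfunctional.
Proof.
apply: primitiveD; [apply: primitiveD; [apply: primitiveD; [apply: primitiveD|]|]|].
- apply: primitive_eq (primitiveM (primitive_expR (2 * delta))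
    (primitive_bform P_posdef.1 XF)) => // t; rewrite /q; ring.
- apply: primitiveB => //; apply: primitive_shift => //.
  exact/q_continuous/psd_sym.
- apply: primitiveB; apply: primitive_shift => //; exact/q_continuous/psd_sym.
- apply: primitiveZ; apply: primitiveB; first exact: primitiveZ.
  apply: primitiveB => //; apply: primitive_shift => //.
  exact: primitive_continuous g0P.
- apply: primitiveZ; apply: primitiveB; first exact: primitiveZ.
  by apply: primitiveB; apply: primitive_shift => //;
    exact: primitive_continuous g1P.
Qed.

Let expD c d : expR (2 * delta * (c - d)) =
  expR (2 * delta * c) * expR (- (2 * delta * d)).
Proof. by rewrite -expRD mulrBr. Qed.

Let jensen_weighted S g a b c : possemidef S -> primitive g (r S) ->
  c <= a -> a <= b ->
  bform S (X b - X a) (X b - X a) <=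
  (b - a) * ((g b - g a) / expR (2 * delta * c)).
Proof.
move=> Spsd gP ca ab; apply: (jensen Spsd XF gP) => //; first exact: expR_gt0.
move=> s /andP[as_ _]; rewrite /r ler_wpM2r//; first exact: Spsd.2.
by rewrite ler_expR ler_pM2l ?mulr_gt0//; lra.
Qed.

Let g_mono S g a b : possemidef S -> primitive g (r S) -> a <= b -> g a <= g b.
Proof.
move=> Spsd gP ab; rewrite -subr_ge0.
have := primitive_le (primitive_cst 0) gP ab; rewrite subrr; apply=> s _.
by rewrite mulr_ge0 ?expR_ge0//; exact: Spsd.2.
Qed.

(** Jensen's inequality on both sides of the instant [tau] (not a delay here), with the increasing
    weight replaced by its value at [c]. At [tau = a] the mixed term vanishes and plain Jensen
    remains. *)
Let convex_bound S G g a b c tau : possemidef S ->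
  possemidef (block_mx S G G^T S) -> primitive g (r S) ->
  a <= tau -> tau <= b -> c <= a ->
  expR (2 * delta * c) * (bform S (X b - X tau) (X b - X tau)
    + bform S (X tau - X a) (X tau - X a)
    + 2 * bform G (X b - X tau) (X tau - X a)) <= (b - a) * (g b - g a).
Proof.
move=> Spsd SG gP ata tb ca; have e0 := expR_gt0 (2 * delta * c).
rewrite -ler_pdivlMl// [X in _ <= X]mulrC -(mulrA (b - a)).
have -> : (b - a) * ((g b - g a) / expR (2 * delta * c)) =
  ((b - tau) + (tau - a)) * ((g b - g tau) / expR (2 * delta * c)
                             + (g tau - g a) / expR (2 * delta * c)).
  by field; rewrite gt_eqF.
apply: reciprocally_convex.
- exact: psd_sym.
- exact: SG.
- by rewrite subr_ge0.
- by rewrite subr_ge0.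
- by rewrite divr_ge0 ?(ltW e0)// subr_ge0; exact: g_mono gP _.
- by rewrite divr_ge0 ?(ltW e0)// subr_ge0; exact: g_mono gP _.
- by move/eqP; rewrite subr_eq0 => /eqP ->; rewrite subrr.
- by move/eqP; rewrite subr_eq0 => /eqP ->; rewrite subrr.
- by apply: jensen_weighted => //; exact: le_trans ata.
- exact: jensen_weighted.
Qed.

Lemma dfunctional_le D t : admissible_velocity X F D t ->
  dfunctional t <= gamma ^+ 2 * D * expR (2 * delta * t).
Proof.
move=> [tau [om [nu [e [/andP[tau0 tauM] Ft omnu cases]]]]].
have [hp etaMp] := (h0, etaM0).
have e0 := expR_gt0 (2 * delta * t).
set x0 := X t in Ft; set x3 := X (t - tau) in Ft cases.
set x1 := X (t - etaM); set x2 := X (t - (h + etaM)).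
have omnu' : gamma ^+ 2 * (sqnorm om + sqnorm nu) <= gamma ^+ 2 * D.
  by rewrite ler_wpM2l// sqr_ge0.
rewrite /dfunctional /q /r !expD -/x0 -/x1 -/x2.
set E := expR (2 * delta * t) in e0 *.
set eeta := expR (- (2 * delta * etaM)).
set etau := expR (- (2 * delta * (h + etaM))).
(* Weights taken at the left ends of the two delay intervals produce exactly the factors [eeta] and
   [etau] of [Psi] and [Phi]. *)
have hJ0 := convex_bound (c := t - etaM) R0_psd RG0_psd g0P.
have hJ1 := convex_bound (c := t - (h + etaM)) R1_psd RG1_psd g1P.
rewrite expD -/E -/eeta in hJ0; rewrite expD -/E -/etau in hJ1.
have Hf : bform (etaM ^+ 2 *: R0 + h ^+ 2 *: R1) (F t) (F t) =
  etaM * (etaM * bform R0 (F t) (F t)) + h * (h * bform R1 (F t) (F t)).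
  by rewrite bformDm !bformZm; ring.
have d0 : t - etaM <= t by lra.
have d1 : t - (h + etaM) <= t - etaM by lra.
case: cases => [[tau_ge ez]|[tau_le trig]].
- have := hJ1 (t - (h + etaM)) (t - etaM) (t - tau).
  rewrite -/x1 -/x2 -/x3 => {}hJ1.
  have d2 : t - (h + etaM) <= t - tau by lra.
  have d3 : t - tau <= t - etaM by lra.
  have {}hJ1 := hJ1 d2 d3 (lexx _).
  (* The delayed instant lies in the other interval, so the splitting is degenerate: plain Jensen
     for [R0]. *)
  have {}hJ0 := hJ0 (t - etaM) t (t - etaM) (lexx _) d0 (lexx _).
  rewrite subrr bform0l bform0r -/x0 -/x1 in hJ0.
  have := Psi_nsd.2 (col_mx x0 (col_mx x1 (col_mx x2 (col_mx x3
    (col_mx om (col_mx nu (F t))))))).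
  rewrite (qform_Psi _ _ _ _ _ _ _ P_posdef.1 (psd_sym R0_psd) (psd_sym R1_psd));
    last by rewrite Ft ez addr0.
  rewrite -/eeta -/etau Hf -(ler_pM2l e0) mulr0 => LMI.
  have := omnu'; rewrite -(ler_pM2l e0) => omE.
  lra.
- have := hJ0 (t - etaM) t (t - tau).
  rewrite -/x0 -/x1 -/x3 => {}hJ0.
  have d2 : t - etaM <= t - tau by lra.
  have d3 : t - tau <= t by lra.
  have {}hJ0 := hJ0 d2 d3 (lexx _).
  have {}hJ1 := hJ1 (t - (h + etaM)) (t - etaM) (t - (h + etaM)) (lexx _)
    d1 (lexx _).
  rewrite subrr bform0l bform0r -/x1 -/x2 in hJ1.
  have := Phi_nsd.2 (col_mx x0 (col_mx x1 (col_mx x2 (col_mx x3 (col_mx e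
    (col_mx om (col_mx nu (F t)))))))).
  rewrite (qform_Phi _ _ _ _ _ _ _ _ P_posdef.1 (psd_sym R0_psd) (psd_sym R1_psd)
    (psd_sym Omega_psd))//.
  rewrite -/eeta -/etau Hf -(ler_pM2l e0) mulr0 => LMI.
  have := omnu'; rewrite -(ler_pM2l e0) => omE.
  have := trig; rewrite -(ler_pM2l e0) => trigE.
  lra.
Qed.

Lemma functional_growth D t0 t : t0 <= t ->
  (forall s, t0 < s < t -> admissible_velocity X F D s) ->
  functional t - functional t0 <=
  gamma ^+ 2 * D / (2 * delta) * (expR (2 * delta * t) - expR (2 * delta * t0)).
Proof.
move=> tt adm; have dp := delta0.
have pE := primitiveZ (gamma ^+ 2 * D / (2 * delta)) (primitive_expR (2 * delta)).
have := primitive_le primitive_functional pE tt; rewrite -mulrBr; apply=> s st.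
apply: le_trans (dfunctional_le (adm s st)) _.
rewrite le_eqVlt; apply/orP; left; apply/eqP; field; lra.
Qed.

(** [g0] and [g1] are nondecreasing, so their integrals over an interval ending no later than [t]
    are at most its length times the value at [t]. This makes the double-integral terms
    nonnegative. *)
Lemma functional_lower t : q P t <= functional t.
Proof.
rewrite /functional; have [hp etaMp] := (h0, etaM0).
have hQ0 : 0 <= Q0 t - Q0 (t - etaM).
  have := primitive_le (primitive_cst 0) Q0P (_ : t - etaM <= t); rewrite subrr.
  apply; first lra.
  by move=> s _; rewrite mulr_ge0 ?expR_ge0//; exact: S0_psd.2.
have hQ1 : 0 <= Q1 (t - etaM) - Q1 (t - (h + etaM)).
  have := primitive_le (primitive_cst 0) Q1P (_ : t - (h + etaM) <= t - etaM).
  rewrite subrr; apply; first lra.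
  by move=> s _; rewrite mulr_ge0 ?expR_ge0//; exact: S1_psd.2.
have hJ0 : J0 t - J0 (t - etaM) <= g0 t * t - g0 t * (t - etaM).
  apply: (primitive_le J0P (primitiveZ (g0 t) primitive_id)); first lra.
  by move=> s /andP[_ /ltW st]; rewrite mulr1; exact: g_mono g0P st.
have hJ1 : J1 (t - etaM) - J1 (t - (h + etaM)) <=
    g1 t * (t - etaM) - g1 t * (t - (h + etaM)).
  apply: (primitive_le J1P (primitiveZ (g1 t) primitive_id)); first lra.
  by move=> s /andP[_ st]; rewrite mulr1; apply: g_mono g1P _ => //; lra.
have : 0 <= etaM * (etaM * g0 t - (J0 t - J0 (t - etaM))).
  by rewrite mulr_ge0//; lra.
have : 0 <= h * (h * g1 t - (J1 (t - etaM) - J1 (t - (h + etaM)))).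
  by rewrite mulr_ge0//; lra.
lra.
Qed.

(** The five summands of the last factor come from [P], [S0], [S1], [R0], [R1] in this order. For
    the last two, monotonicity of [g0] and [g1] bounds the double integral by the interval length
    times the increment of [g0] or [g1]. *)
Lemma functional_upper (c B t : R) : 0 <= c ->
  (forall M, M \in [:: P; S0; S1; R0; R1] -> forall a,
     bform M a a <= c * sqnorm a) ->
  (forall s, s <= t -> sqnorm (X s) <= B /\ sqnorm (F s) <= B) ->
  functional t <= expR (2 * delta * t) *
    (c * B * (1 + etaM + h + etaM ^+ 3 + h ^+ 2 * (h + etaM))).
Proof.
move=> c0 cM XB; have [hp etaMp] := (h0, etaM0).
have B0 : 0 <= B by apply: le_trans (XB t (lexx _)).1; exact: sqnorm_ge0.
set E := expR (2 * delta * t); have E0 : 0 <= E := expR_ge0 _.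
have bd M a s : M \in [:: P; S0; S1; R0; R1] -> s <= t -> 0 <= bform M a a ->
    sqnorm a <= B -> expR (2 * delta * s) * bform M a a <= E * (c * B).
  move=> Min st M0 aB; rewrite ler_pM ?expR_ge0//.
    by rewrite ler_expR ler_pM2l// mulr_gt0.
  by apply: le_trans (cM _ Min _) _; rewrite ler_wpM2l.
have pos M : posdef M \/ possemidef M -> forall a, 0 <= bform M a a.
  case=> [[MT Mp] a|[] //]; have [->|/Mp/ltW//] := eqVneq a 0.
  by rewrite bform0l.
have grow (H k : R -> R) a b : primitive H k -> a <= b -> b <= t ->
    (forall s, s <= t -> k s <= E * (c * B)) -> H b - H a <= E * (c * B) * (b - a).
  move=> Hk ab bt kE; rewrite mulrBr.
  apply: (primitive_le Hk (primitiveZ _ primitive_id) ab) => s /andP[_ sb].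
  by rewrite mulr1; apply: kE; lra.
have hP : q P t <= E * (c * B).
  apply: bd => //; first by rewrite !inE eqxx.
    by apply: pos; left.
  exact: (XB t (lexx _)).1.
have hq M s : M \in [:: P; S0; S1; R0; R1] -> possemidef M -> s <= t ->
    q M s <= E * (c * B).
  move=> Min Mp st; apply: bd => //; first by apply: pos; right.
  exact: (XB s st).1.
have hr M s : M \in [:: P; S0; S1; R0; R1] -> possemidef M -> s <= t ->
    r M s <= E * (c * B).
  move=> Min Mp st; apply: bd => //; first by apply: pos; right.
  exact: (XB s st).2.
have hQ0 : Q0 t - Q0 (t - etaM) <= E * (c * B) * etaM.
  rewrite -[X in _ <= _ * X](subKr t); apply: grow Q0P _ _ _ => //; first lra.
  by move=> s; apply: hq => //; rewrite !inE eqxx ?orbT.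
have hQ1 : Q1 (t - etaM) - Q1 (t - (h + etaM)) <= E * (c * B) * h.
  have -> : h = t - etaM - (t - (h + etaM)) by ring.
  rewrite [in X in _ - Q1 X](_ : _ - _ = t - (h + etaM)); last by ring.
  apply: grow Q1P _ _ _; [lra|lra|].
  by move=> s; apply: hq => //; rewrite !inE eqxx ?orbT.
have hg0 : g0 t - g0 (t - etaM) <= E * (c * B) * (t - (t - etaM)).
  apply: grow g0P _ _ _; [lra|lra|].
  by move=> s; apply: hr => //; rewrite !inE eqxx ?orbT.
have hg1 : g1 t - g1 (t - (h + etaM)) <= E * (c * B) * (t - (t - (h + etaM))).
  apply: grow g1P _ _ _; [lra|lra|].
  by move=> s; apply: hr => //; rewrite !inE eqxx ?orbT.
have hJ0 : g0 (t - etaM) * t - g0 (t - etaM) * (t - etaM) <= J0 t - J0 (t - etaM).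
  apply: (primitive_le (primitiveZ _ primitive_id) J0P); first lra.
  by move=> s /andP[/ltW st _]; rewrite mulr1; exact: g_mono g0P st.
have hJ1 : g1 (t - (h + etaM)) * (t - etaM) - g1 (t - (h + etaM)) * (t - (h + etaM))
    <= J1 (t - etaM) - J1 (t - (h + etaM)).
  apply: (primitive_le (primitiveZ _ primitive_id) J1P); first lra.
  by move=> s /andP[/ltW st _]; rewrite mulr1; exact: g_mono g1P st.
rewrite /functional.
have j0 : etaM * (etaM * g0 t - (J0 t - J0 (t - etaM))) <=
    etaM * (etaM * (E * (c * B) * etaM)).
  rewrite ler_wpM2l//.
  have : etaM * (g0 t - g0 (t - etaM)) <= etaM * (E * (c * B) * (t - (t - etaM))).
    by rewrite ler_wpM2l.
  lra.
have j1 : h * (h * g1 t - (J1 (t - etaM) - J1 (t - (h + etaM)))) <=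
    h * (h * (E * (c * B) * (h + etaM))).
  rewrite ler_wpM2l ?(ltW h0)//.
  have : h * (g1 t - g1 (t - (h + etaM))) <=
      h * (E * (c * B) * (t - (t - (h + etaM)))).
    by rewrite ler_wpM2l ?(ltW h0).
  lra.
lra.
Qed.

End Trajectory.

(** At [t0] the functional depends on the history of state and velocity, so [B] has to bound both on
    the past. [C] is chosen before the trajectory, which makes the estimate uniform. *)
Lemma lyapunov_estimate : exists2 C, 0 <= C &
  forall (X F : R -> 'cV[R]_n) (t0 t B D : R), vprimitive X F -> 0 <= D ->
  t0 <= t ->
  (forall s, s <= t0 -> sqnorm (X s) <= B /\ sqnorm (F s) <= B) ->
  (forall s, t0 < s < t -> admissible_velocity X F D s) ->
  sqnorm (X t) <= C * (expR (- (2 * delta * (t - t0))) * B + D).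
Proof.
have [c c0 cM] : exists2 c, 0 <= c & forall M : 'M[R]_n,
    M \in [:: P; S0; S1; R0; R1] -> forall a, bform M a a <= c * sqnorm a.
  elim: [:: P; S0; S1; R0; R1] => [|M s [c c0 IH]]; first by exists 0.
  have [d d0 H] := bform_upper_bound M.
  exists (c + 2 * d) => [|N]; first by rewrite addr_ge0// mulr_ge0.
  have cq (k e : R) a : 0 <= e -> k <= c * sqnorm a \/ k <= e * (2 * sqnorm a) ->
      k <= (c + 2 * e) * sqnorm (a : 'cV[R]_n).
    move=> e0; have := mulr_ge0 c0 (sqnorm_ge0 a).
    by have := mulr_ge0 e0 (sqnorm_ge0 a) => ? ? [] ?; lra.
  rewrite inE => /predU1P[->|/IH{}IH] a; apply: cq => //; [right|left=> //].
  by apply: le_trans (ler_norm _) _; apply: le_trans (H a a) _; rewrite mulr_natl mulr2n.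
have [p p0 pP] := posdef_lower_bound P_posdef.
have [hp [etaMp dp]] := (h0, (etaM0, delta0)).
pose k := c * (1 + etaM + h + etaM ^+ 3 + h ^+ 2 * (h + etaM)).
pose g := gamma ^+ 2 / (2 * delta).
have k0 : 0 <= k by rewrite !(mulr_ge0, addr_ge0, exprn_ge0)// ltW.
have g0 : 0 <= g by rewrite divr_ge0 ?sqr_ge0// mulr_ge0// ltW.
exists (p * (k + g)) => [|X F t0 t B D XF D0 tt XB adm].
  by rewrite mulr_ge0// addr_ge0.
have B0 : 0 <= B by apply: le_trans (XB _ (lexx _)).1; exact: sqnorm_ge0.
have ex_prim (f df : R -> R) : primitive f df -> exists G, primitive G f.
  move=> /primitive_continuous cf; apply: primitive_exists.
    exact: continuous_measurable_fun.
  exact: continuous_loc_bounded.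
have pE := primitive_expR (2 * delta).
have [Q0 Q0P] := ex_prim _ _ (primitiveM pE (primitive_bform S0_psd.1 XF)).
have [Q1 Q1P] := ex_prim _ _ (primitiveM pE (primitive_bform S1_psd.1 XF)).
have exg M : exists G, primitive G (fun t => expR (2 * delta * t) * bform M (F t) (F t)).
  have cE := primitive_continuous pE; apply: primitive_exists.
    apply: measurable_funM; first exact: continuous_measurable_fun.
    by apply: measurable_bform => i; case: (XF i).
  apply: loc_boundedM; first exact: continuous_loc_bounded.
  by apply: loc_bounded_bform => i; case: (XF i).
have [G0' G0P] := exg R0; have [G1' G1P] := exg R1.
have [J0 J0P] := ex_prim _ _ G0P; have [J1 J1P] := ex_prim _ _ G1P.
have lo := functional_lower Q0P Q1P G0P G1P J0P J1P t.
have hi := functional_upper Q0P Q1P G0P G1P J0P J1P c0 cM XB.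
have gr := functional_growth XF Q0P Q1P G0P G1P J0P J1P tt adm.
have Et := expR_gt0 (2 * delta * t); have Et0 := expR_gt0 (2 * delta * t0).
rewrite -(ler_pM2l Et) mulrCA -[X in _ <= X]mulrA.
have -> : expR (2 * delta * t) * (expR (- (2 * delta * (t - t0))) * B + D) =
    expR (2 * delta * t0) * B + expR (2 * delta * t) * D.
  rewrite mulrDr mulrA -expRD; congr (expR _ * _ + _); ring.
apply: le_trans (_ : expR (2 * delta * t) * (p * bform P (X t) (X t)) <= _).
  by rewrite ler_pM2l.
rewrite [X in X <= _]mulrCA ler_wpM2l//; apply: le_trans lo _.
apply: le_trans (_ : expR (2 * delta * t0) * (k * B) +
  g * D * (expR (2 * delta * t) - expR (2 * delta * t0)) <= _).
  rewrite /g (mulrAC (gamma ^+ 2)); move: gr hi.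
  rewrite (_ : c * B * _ = k * B); last by rewrite /k; ring.
  lra.
have := mulr_ge0 (mulr_ge0 g0 D0) (ltW Et0).
have := mulr_ge0 (mulr_ge0 g0 B0) (ltW Et0).
have := mulr_ge0 (mulr_ge0 k0 D0) (ltW Et).
rewrite mulrDl; lra.
Qed.

End Lyapunov.

(** The rates [al] and [be] come from 2 X^T F <= |X|^2 + |F|^2 and |F|^2 <= 2 |A X|^2 + 2 |B om|^2;
    then exp(- al s) |X(s)|^2 grows at rate at most [be * D]. *)
Lemma gronwall_initial (R : realType) (n p : nat) (A : 'M[R]_n)
    (B : 'M[R]_(n, p)) (b : R) : 0 <= b -> exists2 C, 0 <= C &
  forall (X F : R -> 'cV[R]_n) (t D : R), vprimitive X F -> 0 <= D ->
  0 <= t <= b ->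
  (forall s, 0 < s < t -> exists2 om : 'cV[R]_p, F s = A *m X s + B *m om &
     sqnorm om <= D) ->
  sqnorm (X t) <= C * (sqnorm (X 0) + D).
Proof.
move=> b0; have [cA cA0 hA] := sqnorm_mulmx_bound A.
have [cB cB0 hB] := sqnorm_mulmx_bound B.
pose al := 1 + 2 * cA; pose be := 2 * cB.
have al0 : 0 <= al by rewrite addr_ge0// mulr_ge0.
have be0 : 0 <= be by rewrite mulr_ge0.
exists (expR (al * b) * (1 + be * b)) => [|X F t D XF D0 /andP[t0 tb] HF].
  by rewrite mulr_ge0 ?expR_ge0// addr_ge0// mulr_ge0.
have pN := primitive_bform (trmx1 R n) XF.
have pZ := primitiveM (primitive_expR (- al)) pN.
have /= := primitive_le pZ (primitiveZ (be * D) primitive_id) t0.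
rewrite -!/(sqnorm _) !mulr0 expR0 mul1r subr0 => Z.
have {}Z : expR (- al * t) * sqnorm (X t) - sqnorm (X 0) <= be * D * t.
  apply: Z => s /andP[s0 st].
  have [|om Fs omD] := HF s; first by rewrite s0.
  have N' : 2 * bform 1%:M (X s) (F s) <= al * sqnorm (X s) + be * D.
    have : 2 * bform 1%:M (X s) (F s) <= sqnorm (X s) + sqnorm (F s).
      have := sqnorm_ge0 (X s - F s).
      rewrite /sqnorm !(bformDl, bformDr, bformNl, bformNr).
      rewrite (bform_sym (X s) (F s) (trmx1 R n)); lra.
    have := sqnormD_le (A *m X s) (B *m om); rewrite -Fs.
    have := hA (X s); have := hB om.
    have : cB * sqnorm om <= cB * D by rewrite ler_wpM2l.
    rewrite /al /be; lra.
  have e0 := expR_gt0 (- al * s).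
  rewrite -/(sqnorm (X s)) mulr1.
  apply: le_trans (_ : expR (- al * s) * (be * D) <= _); last first.
    rewrite ler_piMl ?mulr_ge0// -expR0 ler_expR mulNr oppr_le0 mulr_ge0//.
    exact: ltW.
  have := N'; rewrite -(ler_pM2l e0); lra.
have e1 : expR (al * t) * expR (- al * t) = 1.
  by rewrite -expRD mulNr subrr expR0.
have -> : sqnorm (X t) = expR (al * t) * (expR (- al * t) * sqnorm (X t)).
  by rewrite mulrA e1 mul1r.
rewrite -mulrA ler_pM ?expR_ge0//.
- by rewrite mulr_ge0 ?expR_ge0 ?sqnorm_ge0.
- by rewrite ler_expR ler_wpM2l.
- have : be * D * t <= be * D * b by rewrite ler_wpM2l// mulr_ge0.
  have := mulr_ge0 (mulr_ge0 be0 b0) (sqnorm_ge0 (X 0)); lra.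
Qed.

(** * Trajectories of the closed loop *)

Section ClosedLoopTrajectory.
Context {R : realType} {n m l nw nv : nat}.
Variables (A : 'M[R]_n) (B1 : 'M[R]_(n, nw)) (B2 : 'M[R]_(n, m)).
Variables (C2 : 'M[R]_(l, n)) (D2 : 'M[R]_(l, nv)) (K : 'M[R]_(m, l)).
Variables (h etaM eps : R) (Omega : 'M[R]_l).
Hypotheses (h0 : 0 < h) (eps0 : 0 <= eps).
Hypothesis Omega_psd : possemidef Omega.
Local Notation mu := (@lebesgue_measure R).

Lemma vprimitive_exists (F : R -> 'cV[R]_n) (a : 'cV[R]_n) :
  (forall i, measurable_fun [set: R] (fun t => F t i 0)) ->
  (forall i, loc_bounded (fun t => F t i 0)) ->
  exists2 X, vprimitive X F & X 0 = a.
Proof.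
move=> mF lF; pose G i := projT1 (cid (primitive_exists (mF i) (lF i))).
have GP i : primitive (G i) (fun t => F t i 0).
  exact: projT2 (cid (primitive_exists (mF i) (lF i))).
exists (fun t => \col_i (G i t + (a i 0 - G i 0))).
  move=> i; have := primitiveD (GP i) (primitive_cst (a i 0 - G i 0)).
  by apply: primitive_eq => t; rewrite ?mxE ?addr0.
by apply/matrixP => i j; rewrite ord1 mxE addrC subrK.
Qed.

Lemma enormE p (z : 'cV[R]_p) : enorm z = Num.sqrt (sqnorm z).
Proof. by rewrite /enorm sqnormE. Qed.

Lemma enorm_ge0 p (z : 'cV[R]_p) : 0 <= enorm z.
Proof. exact: sqrtr_ge0. Qed.

Lemma sqr_enorm p (z : 'cV[R]_p) : enorm z ^+ 2 = sqnorm z.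
Proof. by rewrite enormE sqr_sqrtr// sqnorm_ge0. Qed.

Lemma sqnorm_col_mx p q (a : 'cV[R]_p) (b : 'cV[R]_q) :
  sqnorm (col_mx a b) = sqnorm a + sqnorm b.
Proof.
by rewrite !sqnormE big_split_ord/=; congr (_ + _); apply: eq_bigr => i _;
  rewrite ?col_mxEu ?col_mxEd.
Qed.

Lemma sqr_coord_le p (z : 'cV[R]_p) i : z i 0 ^+ 2 <= sqnorm z.
Proof. by rewrite sqnormE (bigD1 i)//= lerDl sumr_ge0// => k _; rewrite sqr_ge0. Qed.

(** The least index whose updating time exceeds [t] closes the slot. Minimality also skips the empty
    slots of coinciding updating times. *)
Lemma updating_slot (s eta : nat -> R) t : sampling_instants s ->
  network_delays etaM s eta -> s 0%N + eta 0%N <= t ->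
  exists k, s k + eta k <= t < s k.+1 + eta k.+1.
Proof.
move=> [_ _ s_oo] net t0.
have ex : exists k, t < s k + eta k.
  have /cvgryPgt/(_ t)[N _ HN] := s_oo; exists N.
  have [/andP[e0 _] _] := net N; have := HN N (leqnn N) => /= ; lra.
case: (ex_minnP ex) => -[|k] tk kmin; first by move: tk; rewrite ltNge t0.
exists k; rewrite tk andbT leNgt; apply/negP => /kmin.
by rewrite ltnn.
Qed.

Lemma velocity_bound : exists2 C, 0 <= C &
  forall (a b : 'cV[R]_n) (om : 'cV[R]_nw) (nu : 'cV[R]_nv) (M D : R),
  sqnorm a <= M -> sqnorm b <= M -> sqnorm om <= D -> sqnorm nu <= D ->
  sqnorm (A *m a + B1 *m om + B2 *m (K *m (C2 *m b + D2 *m nu))) <= C * (M + D).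
Proof.
have [c1 c10 h1] := sqnorm_mulmx_bound A.
have [c2 c20 h2] := sqnorm_mulmx_bound B1.
have [c3 c30 h3] := sqnorm_mulmx_bound (B2 *m K *m C2).
have [c4 c40 h4] := sqnorm_mulmx_bound (B2 *m K *m D2).
exists (4 * (c1 + c2 + c3 + c4)) => [|a b om nu M D aM bM omD nuD].
  by rewrite mulr_ge0// !addr_ge0.
have M0 : 0 <= M := le_trans (sqnorm_ge0 a) aM.
have D0 : 0 <= D := le_trans (sqnorm_ge0 om) omD.
rewrite !mulmxDr !mulmxA.
apply: le_trans (sqnormD_le _ _) _.
have := sqnormD_le (A *m a) (B1 *m om).
have := sqnormD_le (B2 *m K *m C2 *m b) (B2 *m K *m D2 *m nu).
have := le_trans (h1 a) (ler_wpM2l c10 aM).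
have := le_trans (h2 om) (ler_wpM2l c20 omD).
have := le_trans (h3 b) (ler_wpM2l c30 bM).
have := le_trans (h4 nu) (ler_wpM2l c40 nuD).
have := mulr_ge0 c10 D0; have := mulr_ge0 c30 D0.
have := mulr_ge0 c20 M0; have := mulr_ge0 c40 M0.
lra.
Qed.

Variables (x : R -> 'cV[R]_n) (w : R -> 'cV[R]_nw) (v : R -> 'cV[R]_nv).
Variables (s eta : nat -> R) (u : R -> 'cV[R]_m) (tau : R -> R).
Let y t := C2 *m x t + D2 *m v t.
Hypotheses (samp : sampling_instants s) (net : network_delays etaM s eta).
Hypothesis trig : event_triggered h eps Omega y s.
Hypothesis ctrl : sampled_control K y s eta u.
Hypothesis cara : caratheodory x (fun t => A *m x t + B1 *m w t + B2 *m u t).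
Hypothesis delay : switched_delay h s eta tau.
Variables (T D : R).
Hypothesis wbar_le : forall t, 0 <= t <= T ->
  sqnorm (delayed_disturbance w v s eta tau t) <= D.

Let s_ge0 k : 0 <= s k.
Proof.
by have [s00 sS _] := samp; elim: k => [|k IH];
  [rewrite s00|apply: le_trans IH (ltW (sS k))].
Qed.

Let eta_ge0 k : 0 <= eta k. Proof. by have [/andP[]] := net k. Qed.
Let eta_le k : eta k <= etaM. Proof. by have [/andP[]] := net k. Qed.
Let t_le k : s k + eta k <= s k.+1 + eta k.+1. Proof. by have [] := net k. Qed.

Let t0_le k : s 0%N + eta 0%N <= s k + eta k.
Proof. by elim: k => // k IH; apply: le_trans IH (t_le k). Qed.

Let w_le t : 0 <= t <= T -> sqnorm (w t) <= D.
Proof.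
move=> /wbar_le; rewrite sqnorm_col_mx; apply: le_trans.
by rewrite lerDl sqnorm_ge0.
Qed.

Let vtau_le t : s 0%N + eta 0%N <= t <= T -> sqnorm (v (t - tau t)) <= D.
Proof.
move=> /andP[t0 tT]; have /wbar_le : 0 <= t <= T.
  by rewrite tT andbT (le_trans _ t0)// addr_ge0.
rewrite sqnorm_col_mx ltNge t0/=; apply: le_trans.
by rewrite lerDr sqnorm_ge0.
Qed.

(* v(s_k) is the value of v(t - tau(t)) at the updating time t_k. *)
Let vs_le k t : s k + eta k <= t < s k.+1 + eta k.+1 -> t <= T ->
  sqnorm (v (s k)) <= D.
Proof.
move=> /andP[tk tk1] tT.
have tkT : s 0%N + eta 0%N <= s k + eta k <= T by rewrite t0_le (le_trans tk tT).
have tauE : tau (s k + eta k) = eta k.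
  rewrite (delay k (s k + eta k)).1; first by rewrite addrAC subrr add0r.
  by rewrite lexx lt_min ltrDl h0 (le_lt_trans tk tk1).
by have := vtau_le tkT; rewrite tauE addrK.
Qed.

(** Puts the open-loop phase, with zero [b] and [nu], and the sampled phase in one form, so that a
    single velocity bound serves both. *)
Lemma control_form t : 0 <= t <= T -> exists (b : 'cV[R]_n) (nu : 'cV[R]_nv),
  [/\ u t = K *m (C2 *m b + D2 *m nu), sqnorm nu <= D &
      forall M, (forall r, 0 <= r <= t -> sqnorm (x r) <= M) -> sqnorm b <= M].
Proof.
move=> /[dup] tT' /andP[t0 tT]; have [tt|tt] := ltP t (s 0%N + eta 0%N).
  exists 0, 0; split.
  - by rewrite !mulmx0 addr0 mulmx0; apply: ctrl.1; rewrite t0.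
  - by rewrite [X in X <= _]bform0l; apply: le_trans (w_le tT'); exact: sqnorm_ge0.
  - move=> M /(_ 0); rewrite lexx t0 => /(_ isT) x0M.
    by rewrite [X in X <= _]bform0l; apply: le_trans x0M; exact: sqnorm_ge0.
have [k tk] := updating_slot samp net tt.
exists (x (s k)), (v (s k)); split; [exact: ctrl.2 tk|exact: vs_le tk tT|].
move=> M; apply; rewrite s_ge0/=; move: tk => /andP[+ _].
by apply: le_trans; rewrite lerDl.
Qed.

(** The factor 2 appears because [w t] and v(s_k) are components of [wbar] at possibly different
    times. The bound [0 <= t - tau0] ensures that the delayed state belongs to the actual trajectory
    and not to its extension. *)
Lemma admissible_sample t : s 0%N + eta 0%N <= t <= T ->
  exists (tau0 : R) (om : 'cV[R]_nw) (nu : 'cV[R]_nv) (e : 'cV[R]_l),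
  [/\ 0 <= tau0 <= h + etaM, 0 <= t - tau0,
      A *m x t + B1 *m w t + B2 *m u t =
      A *m x t + B1 *m om + B2 *m (K *m (C2 *m x (t - tau0) + D2 *m nu + e)),
      sqnorm om + sqnorm nu <= 2 * D &
      (etaM <= tau0 /\ e = 0) \/
      (tau0 <= etaM /\
       qform Omega e <= eps * qform Omega (C2 *m x (t - tau0) + D2 *m nu))].
Proof.
move=> /andP[t0 tT]; have tT' : 0 <= t <= T.
  by rewrite tT andbT (le_trans _ t0)// addr_ge0.
have [k tk] := updating_slot samp net t0; have /andP[tk0 tk1] := tk.
have wD := w_le tT'; have vD := vs_le tk tT; have ut := ctrl.2 k t tk.
have [hp sk] := (h0, s_ge0 k).
have [e0 [eM [e0' eM']]] := (eta_ge0 k, (eta_le k, (eta_ge0 k.+1, eta_le k.+1))).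
(* A sample of age at most h + etaM needs no triggering error at all. This also
   covers t >= t_k + h when s_(k+1) = s_k + h: there the trigger does not bound
   y(s_k) - y(t - tau(t)), because it may already fire at t - tau(t) = s_(k+1). *)
have [age|age] := leP (t - s k) (h + etaM).
  exists (t - s k), (w t), (v (s k)), 0; rewrite subKr; split.
  - by rewrite age andbT; lra.
  - exact: s_ge0.
  - by rewrite addr0 ut.
  - lra.
  - have [?|/ltW ?] := leP etaM (t - s k); [by left|right; split=> //].
    by rewrite [X in X <= _]bform0l mulr_ge0//; exact: Omega_psd.2.
have th : s k + eta k + h <= t by lra.
have sk1 : s k + h < s k.+1 by lra.
have [_ sk1_min] := trig k.
set N := s k.+1 + eta k.+1 - (s k + eta k) - h.
have N0 : 0 < N by rewrite /N; lra.
pose al := (s k.+1 + eta k.+1 - t) / N; pose be := (t - (s k + eta k) - h) / N.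
have al0 : 0 < al by rewrite divr_gt0//; lra.
have be0 : 0 <= be by rewrite divr_ge0//; lra.
have albe : al + be = 1.
  by rewrite -mulrDl -[RHS](@divff _ N) ?gt_eqF// /N; congr (_ / _); ring.
have tauE : tau t = al * eta k + be * eta k.+1.
  by apply: (delay k t).2; rewrite tk1 andbT ge_min th.
(* Interpolating the delays makes t - tau(t) run linearly from s_k + h to s_(k+1). As [al > 0], it
   stays strictly before s_(k+1), so minimality in the trigger says that the condition has not fired
   there. *)
have sgE : t - tau t = al * (s k + h) + be * s k.+1.
  have tE : t = al * (s k + eta k + h) + be * (s k.+1 + eta k.+1).
    by rewrite /al /be /N; field; rewrite -/N gt_eqF.
  rewrite tauE {1}tE; ring.
have al1 : al <= 1 by rewrite -albe lerDl.
have tau0 : 0 <= tau t by rewrite tauE addr_ge0// mulr_ge0// ltW.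
have tauM : tau t <= etaM.
  rewrite tauE -[X in _ <= X]mul1r -albe mulrDl lerD//.
    by rewrite ler_wpM2l// ltW.
  by rewrite ler_wpM2l.
have sg_lo : s k + h <= t - tau t.
  rewrite sgE -[X in X <= _]mul1r -albe mulrDl lerD2l.
  by rewrite ler_wpM2l// ltW.
have sg_hi : t - tau t < s k.+1.
  rewrite sgE -[X in _ < X]mul1r -albe mulrDl ltrD2r.
  by rewrite ltr_pM2l.
exists (tau t), (w t), (v (t - tau t)), (y (s k) - y (t - tau t)); split.
- by rewrite tau0/=; lra.
- lra.
- by rewrite ut -/(y (s k)) -/(y (t - tau t)) [y (t - tau t) + _]addrC subrK.
- by have := vtau_le (_ : _ <= t <= T); rewrite t0 tT => /(_ isT); lra.
- right; split=> //; rewrite -/(y (t - tau t)).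
  have : ~ (eps * qform Omega (y (t - tau t)) <= qform Omega (y (t - tau t) - y (s k))).
    by move=> fires; have := sk1_min (t - tau t) (conj sg_lo fires); lra.
  move=> /negP; rewrite -ltNge => /ltW; apply: le_trans.
  by rewrite -(opprB (y (t - tau t))) !qformE bformNl bformNr opprK.
Qed.

Let f t := A *m x t + B1 *m w t + B2 *m u t.

Hypothesis T0 : 0 <= T.

Let D_ge0 : 0 <= D.
Proof.
by apply: le_trans (wbar_le (_ : 0 <= 0 <= T)); [exact: sqnorm_ge0|rewrite lexx].
Qed.

(** Integrability of the velocity alone gives this. The bound depends on the trajectory and serves
    only to show that the velocity is bounded on the horizon. *)
Let x_bounded : exists2 M, 0 <= M & forall t, 0 <= t <= T -> sqnorm (x t) <= M.
Proof.
pose I i := \int[mu]_(r in `[0, T]) `|f r i 0|.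
have xi t i : 0 <= t <= T -> `|x t i 0| <= `|x 0 i 0| + I i.
  move=> /andP[t0 tT]; have [_ ->] := cara i t0.
  apply: (le_trans (ler_normD _ _)); rewrite lerD2l.
  have [iT _] := cara i T0; have sub : `[0, t] `<=` `[0, T].
    by apply: subset_itvl; rewrite bnd_simp.
  have it : mu.-integrable `[0, t] (EFin \o (fun r => f r i 0)).
    exact: integrableS iT.
  apply: (le_trans (le_normr_Rintegral _ it)) => //.
  rewrite /I -[X in X <= _]add0r -lerBrDr.
  have iTn : mu.-integrable `[0, T] (EFin \o (fun r => `|f r i 0|)).
    by have := integrable_norm iT.
  have := @Rintegral_itvB R (fun r => `|f r i 0|) (BLeft 0) (BRight T) t iTn.
  by rewrite !bnd_simp => -> //; apply: Rintegral_ge0.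
exists (\sum_i (`|x 0 i 0| + I i) ^+ 2).
  by rewrite sumr_ge0// => i _; rewrite sqr_ge0.
move=> t tT; rewrite sqnormE ler_sum// => i _.
have := xi t i tT; rewrite -[X in _ -> X <= _]real_normK ?num_real// => xiT.
by rewrite lerXn2r// nnegrE// (le_trans _ xiT).
Qed.

(** Primitives need a velocity that is measurable and locally bounded on the whole line. Setting it
    to 0 outside [[0, T]] achieves that and keeps the state at x(0) in the past. *)
Lemma trajectory_extension : exists X F : R -> 'cV[R]_n,
  [/\ vprimitive X F, forall t, 0 <= t <= T -> X t = x t,
      forall t, 0 <= t <= T -> F t = f t,
      forall t, t <= 0 -> X t = x 0 & forall t, t < 0 -> F t = 0].
Proof.
pose F t := if t \in `[0, T] then f t else 0.
have FE t : 0 <= t <= T -> F t = f t by rewrite /F in_itv/= => ->.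
have F0 t : t < 0 -> F t = 0.
  by rewrite /F in_itv/= => tneg; rewrite leNgt tneg.
have mF i : measurable_fun [set: R] (fun t => F t i 0).
  have -> : (fun t => F t i 0) = (fun t => f t i 0) \_ `[0, T].
    apply/funext => t; rewrite patchE /F mem_setE; case: ifP => // _.
    by rewrite mxE.
  apply/(measurable_restrictT _ _).1 => //.
  by have [iT _] := cara i T0; apply/measurable_EFinP; exact: measurable_int iT.
have lF i : loc_bounded (fun t => F t i 0).
  have [M M0 xM] := x_bounded; have [C C0 HC] := velocity_bound.
  (* The 1 turns a bound on a square into one on the absolute value: z^2 <= c implies |z| <= c +
     1. *)
  move=> N; exists (C * (M + D) + 1) => t _.
  have CMD : 0 <= C * (M + D) by rewrite mulr_ge0// addr_ge0.
  rewrite /F in_itv/=; case: ifPn => [tT|_]; last by rewrite mxE normr0 addr_ge0.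
  have fM : sqnorm (f t) <= C * (M + D).
    have [b [nu [uE nuD bM]]] := control_form tT; rewrite /f uE; apply: HC => //.
    - exact: xM.
    - apply: bM => r /andP[r0 rt]; apply: xM; rewrite r0/=.
      by move: tT => /andP[_]; exact: le_trans.
    - exact: w_le.
  have := le_trans (sqr_coord_le (f t) i) fM.
  rewrite -[X in X <= _ -> _]real_normK ?num_real//.
  by have := normr_ge0 (f t i 0) => ? ?; nra.
have [X XF X0] := vprimitive_exists (x 0) mF lF.
exists X, F; split=> // t.
- move=> /andP[t0 tT]; apply/matrixP => i j; rewrite ord1.
  have [_ _ /(_ _ _ t0)] := XF i; rewrite X0 => /eqP.
  rewrite subr_eq addrC => /eqP ->; have [_ ->] := cara i t0; congr (_ + _).
  apply: eq_Rintegral => r; rewrite inE/= in_itv/= => /andP[r0 rt].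
  by rewrite FE// r0 (le_trans rt).
- move=> t0; rewrite -X0; apply: (vprimitive_constant XF t0) => r /andP[_].
  exact: F0.
Qed.

End ClosedLoopTrajectory.

(** * A uniform estimate for squared norms, and input-to-state stability *)

Lemma closed_loop_estimate (R : realType) (n m l nw nv : nat)
    (A : 'M[R]_n) (B1 : 'M[R]_(n, nw)) (B2 : 'M[R]_(n, m))
    (C2 : 'M[R]_(l, n)) (D2 : 'M[R]_(l, nv)) (K : 'M[R]_(m, l))
    (gamma h etaM eps delta : R)
    (P S0 S1 R0 R1 G0 G1 : 'M[R]_n) (Omega : 'M[R]_l) :
  0 < h -> 0 <= etaM -> 0 <= eps -> 0 < delta -> posdef P ->
  possemidef S0 -> possemidef S1 -> possemidef R0 -> possemidef R1 ->
  possemidef Omega ->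
  negsemidef (Psi A B1 B2 C2 D2 K gamma h etaM delta P S0 S1 R0 R1 G1) ->
  negsemidef
    (Phi A B1 B2 C2 D2 K gamma h etaM eps delta P S0 S1 R0 R1 G0 Omega) ->
  possemidef (block_mx R0 G0 G0^T R0) ->
  possemidef (block_mx R1 G1 G1^T R1) ->
  exists2 C, 0 <= C & forall x wbar (T D : R),
    closed_loop A B1 B2 C2 D2 K h etaM eps Omega x wbar -> 0 <= T ->
    (forall t, 0 <= t <= T -> sqnorm (wbar t) <= D) ->
    sqnorm (x T) <= C * (expR (- (2 * delta * T)) * sqnorm (x 0) + D).
Proof.
move=> h0 etaM0 eps0 delta0 Pp S0p S1p R0p R1p Op Psin Phin RG0 RG1.
have [CL CL0 HL] := lyapunov_estimate h0 etaM0 delta0 Pp S0p S1p R0p R1p Op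
  Psin Phin RG0 RG1.
have [CG CG0 HG] := gronwall_initial A B1 etaM0.
have [CF CF0 HF] := velocity_bound A B1 B2 C2 D2 K.
(* In units of |x(0)|^2 + D, [CG + 1] bounds the squared state up to the first updating time,
   including the constant past, and the other summand of [k] bounds the squared velocity. The factor
   [eM] pays for the decay missing up to that time. *)
pose k := CG + 1 + CF * (CG + 2).
pose eM := expR (2 * delta * etaM).
have k0 : 0 <= k by rewrite !addr_ge0// mulr_ge0// addr_ge0.
have eM0 : 0 <= eM := expR_ge0 _.
exists (CG * eM + CG + CL * (k * eM + k + 2)).
  by rewrite !(addr_ge0, mulr_ge0).
move=> x wbar T D.
move=> [w [v [s [eta [u [tau [[samp net] trig ctrl cara [delay wbE]]]]]]]] T0 wbD.
have wbar_le t : 0 <= t <= T -> sqnorm (delayed_disturbance w v s eta tau t) <= D.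
  by move=> /[dup] /andP[t0 _] /wbD; rewrite wbE.
have w_le t : 0 <= t <= T -> sqnorm (w t) <= D.
  by move=> /wbar_le; rewrite sqnorm_col_mx; apply: le_trans; rewrite lerDl sqnorm_ge0.
have D0 : 0 <= D.
  by have := w_le 0; rewrite lexx T0 => /(_ isT); apply: le_trans; exact: sqnorm_ge0.
have [X [F [XF Xx Ff Xneg Fneg]]] :=
  trajectory_extension h0 samp net ctrl cara delay wbar_le T0.
have X0 : X 0 = x 0 by apply: Xneg.
set N := sqnorm (x 0); have N0 : 0 <= N := sqnorm_ge0 _.
have sz : s 0%N = 0 by case: samp.
have [/andP[e0 eM'] _] := net 0%N.
have early t : 0 <= t <= eta 0%N -> t <= T -> sqnorm (X t) <= CG * (N + D).
  move=> /andP[t0 te] tT; rewrite /N -X0; apply: (HG _ _ _ _ XF D0).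
    by rewrite t0 (le_trans te).
  move=> r /andP[r0 rt]; have rT : 0 <= r <= T by rewrite ltW//= (le_trans (ltW rt)).
  exists (w r); last exact: w_le.
  rewrite (Ff r rT) (Xx r rT) (ctrl.1 r) ?mulmx0 ?addr0// sz add0r ltW//=.
  exact: lt_le_trans te.
have eT : 0 <= expR (- (2 * delta * T)) := expR_ge0 _.
have eTN : 0 <= expR (- (2 * delta * T)) * N by rewrite mulr_ge0.
rewrite -(Xx T) ?T0 ?lexx//.
have [Te|eT0] := leP T (eta 0%N).
  apply: le_trans (early T _ (lexx _)) _; first by rewrite T0.
  have hE : N <= eM * (expR (- (2 * delta * T)) * N).
    rewrite mulrA -expRD -[X in X <= _]mul1r ler_wpM2r// -expR0 ler_expR.
    by rewrite -mulrBr mulr_ge0//; [rewrite mulr_ge0// ltW|lra].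
  have : CG * N <= CG * (eM * (expR (- (2 * delta * T)) * N)) by rewrite ler_wpM2l.
  have kk : 0 <= CL * (k * eM + k + 2).
    by rewrite !(addr_ge0, mulr_ge0).
  have := mulr_ge0 kk eTN; have := mulr_ge0 kk D0.
  have := mulr_ge0 CG0 eTN; have := mulr_ge0 (mulr_ge0 CG0 eM0) D0.
  lra.
set M := CG * (N + D) + N.
have M0 : 0 <= M by rewrite addr_ge0// mulr_ge0// addr_ge0.
have XM r : r <= eta 0%N -> sqnorm (X r) <= M.
  move=> re; have [r0|r0] := leP 0 r.
    apply: le_trans (early r _ _) _; [by rewrite r0| |by rewrite lerDl].
    by rewrite (le_trans re)// ltW.
  by rewrite Xneg ?(ltW r0)// -/N lerDr mulr_ge0// addr_ge0.
have FM r : r <= eta 0%N -> sqnorm (F r) <= CF * (M + D).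
  move=> re; have [r0|r0] := leP 0 r; last first.
    by rewrite Fneg// [X in X <= _]bform0l mulr_ge0// addr_ge0.
  have rT : 0 <= r <= T by rewrite r0 (le_trans re)// ltW.
  (* At [r = eta 0] itself the control may already be active, so it cannot be set to 0 on this
     closed range. *)
  have [b [nu [uE nuD bM]]] := control_form h0 samp net ctrl delay wbar_le rT.
  rewrite (Ff r rT) uE; apply: HF => //; last exact: w_le.
    by rewrite -(Xx r rT) XM.
  apply: bM => r' /andP[r'0 r'r]; rewrite -Xx; last first.
    by rewrite r'0 (le_trans r'r)//; move: rT => /andP[].
  by apply: XM; exact: le_trans re.
have adm r : eta 0%N < r < T ->
    admissible_velocity A B1 B2 C2 D2 K h etaM eps Omega X F (2 * D) r.
  move=> /andP[er rT].
  have r0 : s 0%N + eta 0%N <= r <= T by rewrite sz add0r !ltW.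
  have rT' : 0 <= r <= T by rewrite (ltW rT) andbT (le_trans e0)// ltW.
  have [tau0 [om [nu [e [tauM tau_r vE omD cases]]]]] :=
    admissible_sample A B1 B2 h0 eps0 Op samp net trig ctrl delay wbar_le r0.
  have tau0T : 0 <= r - tau0 <= T.
    by rewrite tau_r/= lerBlDr (le_trans (ltW rT))// lerDl; case/andP: tauM.
  exists tau0, om, nu, e; split=> //; rewrite ?(Xx _ tau0T)//.
  by rewrite (Ff r rT') (Xx r rT').
have B_le r : r <= eta 0%N -> sqnorm (X r) <= k * (N + D) /\ sqnorm (F r) <= k * (N + D).
  have MN : M <= (CG + 1) * (N + D) by rewrite /M; lra.
  have FN : CF * (M + D) <= CF * ((CG + 2) * (N + D)) by rewrite ler_wpM2l//; lra.
  have ND : 0 <= N + D by rewrite addr_ge0.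
  have p1 : 0 <= (CG + 1) * (N + D) by rewrite mulr_ge0// addr_ge0.
  have p2 : 0 <= CF * ((CG + 2) * (N + D)) by rewrite !mulr_ge0// addr_ge0.
  by move=> re; have := XM r re; have := FM r re; rewrite /k => ? ?; split; lra.
have D20 : 0 <= 2 * D by rewrite mulr_ge0.
apply: le_trans (HL X F _ T _ _ XF D20 (ltW eT0) B_le adm) _.
set E := expR _.
have E1 : E <= 1.
  by rewrite /E -expR0 ler_expR oppr_le0 !mulr_ge0// ?(ltW delta0)// subr_ge0 ltW.
have Ee : E <= eM * expR (- (2 * delta * T)).
  rewrite /E -expRD ler_expR mulrBr opprB lerD2r ler_wpM2l// mulr_ge0//.
  exact: ltW.
have H1 : E * N <= eM * (expR (- (2 * delta * T)) * N) by rewrite mulrA ler_wpM2r.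
have H2 : E * D <= 1 * D by rewrite ler_wpM2r.
have H3 : k * (E * N + E * D) <= k * (eM * (expR (- (2 * delta * T)) * N) + D).
  by rewrite ler_wpM2l//; lra.
have H4 : E * (k * (N + D)) + 2 * D <=
  (k * eM + k + 2) * (expR (- (2 * delta * T)) * N + D).
  have := mulr_ge0 k0 eTN; have := mulr_ge0 (mulr_ge0 k0 eM0) D0; lra.
apply: le_trans (ler_wpM2l CL0 H4) _.
rewrite mulrA ler_wpM2r ?addr_ge0// lerDr.
by rewrite addr_ge0// mulr_ge0.
Qed.

Theorem corollary1 (R : realType) (n m l nw nv : nat)
    (A : 'M[R]_n) (B1 : 'M[R]_(n, nw)) (B2 : 'M[R]_(n, m))
    (C2 : 'M[R]_(l, n)) (D2 : 'M[R]_(l, nv)) (K : 'M[R]_(m, l))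
    (gamma h etaM eps delta : R)
    (P S0 S1 R0 R1 G0 G1 : 'M[R]_n) (Omega : 'M[R]_l) :
  0 < gamma -> 0 < h -> 0 <= etaM -> 0 <= eps -> 0 < delta ->
  posdef P ->
  possemidef S0 -> possemidef S1 -> possemidef R0 -> possemidef R1 ->
  possemidef Omega ->
  negsemidef (Psi A B1 B2 C2 D2 K gamma h etaM delta P S0 S1 R0 R1 G1) ->
  negsemidef
    (Phi A B1 B2 C2 D2 K gamma h etaM eps delta P S0 S1 R0 R1 G0 Omega) ->
  possemidef (block_mx R0 G0 G0^T R0) ->
  possemidef (block_mx R1 G1 G1^T R1) ->
  input_to_state_stable (closed_loop A B1 B2 C2 D2 K h etaM eps Omega).
Proof.
move=> _ h0 etaM0 eps0 delta0 Pp S0p S1p R0p R1p Op Psin Phin RG0 RG1.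
have [C C0 HC] := closed_loop_estimate h0 etaM0 eps0 delta0 Pp S0p S1p R0p R1p Op
  Psin Phin RG0 RG1.
(* Replaces the square root of [C]: its square dominates [C], and it is positive even for [C = 0],
   as strict monotonicity of the gains demands. *)
pose c := C + 1.
have c0 : 0 < c by rewrite ltr_wpDl.
have Cc : C <= c ^+ 2 by rewrite /c; nra.
have cexp : continuous (fun t : R => expR (- (delta * t))).
  move=> t; apply: continuous_comp; last exact: continuous_expR.
  by apply: cvgN; apply: cvgM; [exact: cvg_cst|exact: cvg_id].
(* The squared norm decays at rate [2 * delta], hence the rate [delta] here. The squared estimate
   passes to the sum by a^2 + b^2 <= (a + b)^2 for nonnegative a and b. *)
exists (fun r t => c * r * expR (- (delta * t))), (fun r => c * r); split.
- split.
  + apply: continuous_subspaceT => p; apply: cvgM.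
      by apply: cvgM; [exact: cvg_cst|exact: cvg_fst].
    apply: (@continuous_comp _ _ _ snd (fun t => expR (- (delta * t)))).
      exact: cvg_snd.
    exact: cexp.
  + move=> t t0; split; [|by rewrite mulr0 mul0r|].
      apply: continuous_subspaceT => r; apply: cvgM; last exact: cvg_cst.
      by apply: cvgM; [exact: cvg_cst|exact: cvg_id].
    by move=> a b _ ab; rewrite ltr_pM2r ?expR_gt0// ltr_pM2l.
  + move=> r a b r0 a0 ab; rewrite ler_wpM2l ?mulr_ge0 ?(ltW c0)//.
    by rewrite ler_expR lerN2 ler_pM2l.
  + move=> r r0; rewrite -[X in _ --> X](mulr0 (c * r)).
    apply: cvgM; first exact: cvg_cst.
    apply: (@cvg_comp _ _ _ (fun t => delta * t) (fun t => expR (- t))).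
      apply/cvgryPgt => a; near=> t; rewrite mulrC -ltr_pdivrMr//.
      by near: t; apply: nbhs_pinfty_gt; exact: num_real.
    exact: cvgr_expR.
- split; [|by rewrite mulr0|by move=> a b _ ab; rewrite ltr_pM2l].
  by apply: continuous_subspaceT => r; apply: cvgM; [exact: cvg_cst|exact: cvg_id].
- move=> x d cl [M dM] t t0; set S := sup _.
  have Sub r : 0 <= r <= t -> enorm (d r) <= S.
    move=> rt; apply: ub_le_sup.
      by exists M => _ [r' /= + <-]; rewrite in_itv/= => /andP[r'0 _]; exact: dM.
    by exists r => //=; rewrite in_itv.
  have Sge0 : 0 <= S.
    by have := Sub 0; rewrite lexx t0 => /(_ isT); apply: le_trans; exact: enorm_ge0.
  have sqS r : 0 <= r <= t -> sqnorm (d r) <= S ^+ 2.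
    by move=> rt; rewrite -sqr_enorm lerXn2r ?nnegrE ?enorm_ge0// Sub.
  have := HC x d t _ cl t0 sqS; rewrite -!sqr_enorm => est.
  have e0 := expR_ge0 (- (delta * t)); have x0 := enorm_ge0 (x 0).
  rewrite -(@ler_pXn2r _ 2) ?nnegrE ?enorm_ge0//; last first.
    by rewrite addr_ge0 ?mulr_ge0 ?(ltW c0).
  apply: le_trans est _.
  have -> : expR (- (2 * delta * t)) = expR (- (delta * t)) ^+ 2.
    by rewrite expr2 -expRD; congr expR; ring.
  apply: le_trans (_ : c ^+ 2 *
    (expR (- (delta * t)) ^+ 2 * enorm (x 0) ^+ 2 + S ^+ 2) <= _).
    by rewrite ler_wpM2r// addr_ge0 ?mulr_ge0 ?sqr_ge0.
  have -> : c * enorm (x 0) * expR (- (delta * t)) + c * S =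
    c * (expR (- (delta * t)) * enorm (x 0) + S) by ring.
  rewrite exprMn ler_wpM2l ?sqr_ge0// sqrrD -exprMn.
  by rewrite -addrA lerD2l lerDr mulrn_wge0// !mulr_ge0.
Unshelve. all: by end_near. Qed.
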